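(* Let $H$ be the generic Hecke algebra over $\mathcal Z=\mathbb Z[t,t^{-1}]$ of a Weyl group $(W,S)$ attached to a family of finite groups of Lie type with parameters $c_s$ ($s\in S$, not necessarily equal), let $K$ be the fraction field of $\mathcal Z$, let $\Omega$ be the set of left cells of $W$, and let $\operatorname{ht}:\Omega\to\mathbb N$ be a height function compatible with $\leq_{LR}^{\mathrm{op}}$. For $\omega\in\Omega$ let $[\omega]$ be the two-sided cell containing $\omega$ and $S[\omega]$ the associated two-sided cell module, viewed as a left $H$-module. (1) All irreducible $H_K$-modules appear in some $S[\omega]_K$. (2) Let $\mathfrak m$ be any fixed maximal ideal of $\mathcal Z$ and let $D$ be an irreducible $H(\mathfrak m)$-module. There is a unique two-sided cell $[\omega]=[\omega](D)$ with $[S[\omega](\mathfrak m):D]\neq0$ and $[S[\nu](\mathfrak m):D]=0$ for any $\nu\in\Omega$ with $\operatorname{ht}(\nu)\leq\operatorname{ht}(\omega)$ and $[\nu]\neq[\omega]$. (3) For $\mathfrak m$, $D$ and $[\omega]=[\omega](D)$ as in (2), $D$ is in the head of $S[\omega](\mathfrak m)$.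
   Context: For a maximal ideal $\mathfrak m$ of $\mathcal Z$ and a $\mathcal Z$-module $X$, $X(\mathfrak m)=X/\mathfrak mX$ and $X_K=K\otimes_{\mathcal Z}X$; $[V:D]$ denotes composition multiplicity; the head of a module is its largest semisimple quotient. **Hecke algebra.** $\mathcal Z=\mathbb Z[t,t^{-1}]$, $K=\mathbb Q(t)$. $(W,S)$ is the finite Coxeter system (Weyl group) of the BN-pairs of a family $\{G(q)\}$ of finite groups of Lie type (Suzuki and Ree groups excluded), with index parameters $c_s\in\mathbb Z_{>0}$ given by $[B(q):{}^sB(q)\cap B(q)]=q^{c_s}$. $H$ is the $\mathcal Z$-algebra with basis $\{T_w\}_{w\in W}$ and relations $T_sT_w=T_{sw}$ if $sw>w$, and $T_sT_w=t^{2c_s}T_{sw}+(t^{2c_s}-1)T_w$ if $sw<w$ ($s\in S$, $w\in W$). $H_K=K\otimes_{\mathcal Z}H$ is split semisimple. **Cells.** Put $c(w)=\sum c_{s_i}$ for a reduced expression $w=s_1\cdots s_l$, and $\tilde T_w=t^{-c(w)}T_w$. The Kazhdan–Lusztig basis $\{C_w\}$ is characterized by: $C_w$ is fixed by the ring involution $t\mapsto t^{-1}$, $\tilde T_x\mapsto\tilde T_{x^{-1}}^{-1}$, and $C_w\in\tilde T_w+\sum_{y<w}t^{-1}\mathbb Z[t^{-1}]\tilde T_y$. The pre-order $\leq_L$ (resp. $\leq_{LR}$) on $W$ is generated by: $x\leq y$ if $C_x$ occurs with nonzero coefficient in $C_sC_y$ (resp. in $C_sC_y$ or $C_yC_s$)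 for some $s\in S$. Equivalence classes are the left (resp. two-sided) cells; each left cell is contained in a two-sided cell, and $\leq_{LR}$ and its opposite $\leq_{LR}^{\mathrm{op}}$ are defined on left and two-sided cells. The two-sided cell module of a two-sided cell $[\omega]$ is the span of the $C_x$ with $x\leq_{LR}y$ ($y\in[\omega]$), modulo the span of those $C_x$ with $x\leq_{LR}y$ and $x\notin[\omega]$. **Height.** $\operatorname{ht}$ is compatible with $\leq_{LR}^{\mathrm{op}}$: $\operatorname{ht}(\omega)<\operatorname{ht}(\nu)$ whenever $\omega<_{LR}^{\mathrm{op}}\nu$ strictly, and $\operatorname{ht}(\omega)=\operatorname{ht}(\nu)$ whenever $[\omega]=[\nu]$. *)

(* Defs.v *)
From HB Require Import structures.
From mathcomp Require Import all_boot all_order all_algebra all_fingroup.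
From mathcomp Require Import gproduct pgroup.
From mathcomp Require Import fraction ring_quotient generic_quotient.
From mathcomp Require Import boolp.
From mathcomp Require classical_sets.

Set Implicit Arguments.
Unset Strict Implicit.
Unset Printing Implicit Defensive.

Import GRing.Theory.
Local Open Scope ring_scope.
Local Open Scope quotient_scope.

Section Submodules.
Variables (R : pzRingType) (V : lmodType R).

Definition mk_submod (P : {pred V}) (hP : submod_closed P) : submodClosed V :=
  HB.pack_for (submodClosed V) (P : V -> bool)
    (GRing.isSubmodClosed.Build R V P hP).

Variable U : submodClosed V.

Definition submod : Type := {x : V | x \in U}.
HB.instance Definition _ := SubType.on submod.
HB.instance Definition _ := Choice.on submod.
HB.instance Definition _ := [SubChoice_isSubLmodule of submod by <:].

Definition submod_pred : V -> bool := fun x => x \in U.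

Lemma submod_zmod_closed : zmod_closed (submod_pred : {pred V}).
Proof. exact: GRing.submod_closedB (submodClosedP U). Qed.

Definition submod_zmod : zmodClosed V :=
  HB.pack_for (zmodClosed V) submod_pred
    (GRing.isZmodClosed.Build V submod_pred submod_zmod_closed).

Definition quomod : Type := Quotient.quot submod_zmod.
HB.instance Definition _ := GRing.Zmodule.on quomod.

Definition quomod_pi (x : V) : quomod := \pi_(Quotient.quot submod_zmod) x.

Definition quomod_repr (q : quomod) : V := repr (q : Quotient.quot submod_zmod).

Lemma quomod_piP x y : (quomod_pi x = quomod_pi y) <-> (x - y \in U).
Proof.
have -> : (x - y \in U) = (x - y \in submod_zmod) by [].
by rewrite Quotient.idealrBE; split => [/eqP|/eqP].
Qed.

Lemma quomod_piK (q : quomod) : quomod_pi (quomod_repr q) = q.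
Proof. exact: reprK. Qed.

Lemma quomod_piD x y : quomod_pi (x + y) = quomod_pi x + quomod_pi y.
Proof. exact: raddfD. Qed.

Definition quomod_scale (a : R) (q : quomod) : quomod :=
  quomod_pi (a *: quomod_repr q).

Lemma quomod_scaleE a x : quomod_scale a (quomod_pi x) = quomod_pi (a *: x).
Proof.
apply/quomod_piP; rewrite -scalerBr rpredZ //.
exact/quomod_piP/quomod_piK.
Qed.

Lemma quomod_scaleA a b v :
  quomod_scale a (quomod_scale b v) = quomod_scale (a * b) v.
Proof. by rewrite -[v]quomod_piK !quomod_scaleE scalerA. Qed.
Lemma quomod_scale1 : left_id 1 quomod_scale.
Proof. by move=> v; rewrite -[v]quomod_piK !quomod_scaleE scale1r. Qed.
Lemma quomod_scaleDr : right_distributive quomod_scale +%R.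
Proof.
move=> a u v; rewrite -[u]quomod_piK -[v]quomod_piK -quomod_piD !quomod_scaleE.
by rewrite scalerDr quomod_piD.
Qed.
Lemma quomod_scaleDl v : {morph quomod_scale^~ v : a b / a + b}.
Proof.
move=> a b; rewrite -[v]quomod_piK !quomod_scaleE.
by rewrite scalerDl quomod_piD.
Qed.

HB.instance Definition _ := GRing.Zmodule_isLmodule.Build R quomod
  quomod_scaleA quomod_scale1 quomod_scaleDr quomod_scaleDl.

End Submodules.

Section Factors.
Variables (R : pzRingType) (V : lmodType R) (N M : submodClosed V).

Definition restr_pred : {pred submod N} := fun x => val x \in M.

Lemma restr_closed : submod_closed restr_pred.
Proof.
split=> [|a x y xM yM].
  have -> : (0 \in restr_pred) = (val (0 : submod N) \in M) by [].
  by rewrite raddf0 rpred0.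
have -> : (a *: x + y \in restr_pred) = (val (a *: x + y) \in M) by [].
have -> : val (a *: x + y) = a *: val x + val y by [].
by rewrite rpredD // rpredZ.
Qed.

(* The subquotient N / (N :&: M). *)
Definition factor : lmodType R := quomod (mk_submod restr_closed).
End Factors.

Section ModuleNotions.
Variable R : pzRingType.
Implicit Types V D : lmodType R.

Definition iso_mod V D : Prop := exists f : {linear V -> D}, bijective f.

Definition simple_mod V : Prop :=
  (exists x : V, x != 0) /\
  forall U : submodClosed V, (forall x, x \in U -> x = 0) \/ (forall x, x \in U).

Definition semisimple_mod V : Prop :=
  forall U : submodClosed V, exists U' : submodClosed V,
    (forall x, x \in U -> x \in U' -> x = 0) /\
    (forall x, exists2 u, u \in U & x - u \in U').

Definition composition_series V n (F : nat -> submodClosed V) : Prop :=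
  [/\ forall x, x \in F 0%N -> x = 0,
      forall x, x \in F n
    & forall i, (i < n)%N ->
        {subset F i <= F i.+1} /\ simple_mod (factor (F i.+1) (F i))].

Definition has_comp_mult V D (k : nat) : Prop :=
  exists n (F : nat -> submodClosed V), composition_series n F /\
    k = #|[set i : 'I_n | `[< iso_mod (factor (F i.+1) (F i)) D >] ]|.

(* By Jordan-Hoelder the multiplicity does not depend on the composition
   series; the default 0 is only used for modules without such a series. *)
Definition comp_mult V D : nat :=
  @classical_sets.xget nat 0%N (has_comp_mult V D).

Definition head_kernel_pred V : {pred V} :=
  fun x => `[< forall U : submodClosed V, semisimple_mod (quomod U) -> x \in U >].

Lemma head_kernel_closed V : submod_closed (@head_kernel_pred V).
Proof.
split=> [|a x y /asboolP xU /asboolP yU]; apply/asboolP => U sU.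
  exact: rpred0.
by rewrite rpredD ?rpredZ ?xU ?yU.
Qed.

(* If V has a largest semisimple quotient (as is the case when V has finite
   length), then head V is that quotient. *)
Definition head V : lmodType R := quomod (mk_submod (@head_kernel_closed V)).

Definition in_head V D : Prop := comp_mult (head V) D <> 0%N.

End ModuleNotions.

Definition maximal_ideal (A : comNzRingType) (m : {pred A}) : Prop :=
  idealr_closed m /\
  forall J : {pred A}, idealr_closed J -> {subset m <= J} -> {subset J <= m}.

Section Reduction.
Variables (A : comNzRingType) (H : algType A) (m : {pred A}).

Section Span.
Variable X : lmodType H.

(* The submodule m X, where a in A acts on X as a%:A. *)
Definition mspan_pred : {pred X} := fun x =>
  `[< exists2 s : seq (A * X), all (fun p => p.1 \in m) s
                             & x = \sum_(p <- s) (p.1)%:A *: p.2 >].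

Lemma mspan_closed : submod_closed mspan_pred.
Proof.
split=> [|h x y /asboolP[s sm ->] /asboolP[s' sm' ->]]; apply/asboolP.
  by exists [::]; rewrite // big_nil.
exists ([seq (p.1, h *: p.2) | p <- s] ++ s').
  rewrite all_cat sm' andbT all_map; exact: sm.
rewrite big_cat big_map scaler_sumr; congr (_ + _); apply: eq_bigr => p _ /=.
by rewrite !scalerA mulr_algl mulr_algr.
Qed.

Definition mspan : submodClosed X := mk_submod mspan_closed.
End Span.

Definition redalg : Type := quomod (mspan H^o).
HB.instance Definition _ := GRing.Zmodule.on redalg.

Definition redalg_pi (h : H) : redalg := quomod_pi (mspan H^o) h.

Lemma redalg_piP (x y : H) :
  (redalg_pi x = redalg_pi y) <-> ((x - y : H^o) \in mspan H^o).
Proof. exact: quomod_piP. Qed.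

Lemma redalg_piK (q : redalg) :
  redalg_pi (quomod_repr q) = q.
Proof. exact: quomod_piK. Qed.

Lemma redalg_piD x y : redalg_pi (x + y) = redalg_pi x + redalg_pi y.
Proof. exact: quomod_piD. Qed.

Lemma mspan_mulr (x h : H) : (x : H^o) \in mspan H^o -> (x * h : H^o) \in mspan H^o.
Proof.
move=> /asboolP[s sm ->]; apply/asboolP.
exists [seq (p.1, (p.2 : H) * h : H^o) | p <- s].
  rewrite all_map; exact: sm.
rewrite big_map mulr_suml; apply: eq_bigr => p _ /=.
by rewrite -[RHS]/(_ * (_ * _)) mulrA.
Qed.

Lemma mspan_act (X : lmodType H) (h : H) (x : X) :
  (h : H^o) \in mspan H^o -> h *: x \in mspan X.
Proof.
move=> /asboolP[s sm ->]; apply/asboolP.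
exists [seq (p.1, (p.2 : H) *: x) | p <- s].
  rewrite all_map; exact: sm.
by rewrite big_map scaler_suml; apply: eq_bigr => p _ /=; rewrite scalerA.
Qed.

Definition redalg_mul (p q : redalg) : redalg :=
  redalg_pi ((quomod_repr p : H)
             * (quomod_repr q : H)).

Lemma redalg_mulE x y :
  redalg_mul (redalg_pi x) (redalg_pi y) = redalg_pi (x * y).
Proof.
rewrite /redalg_mul; pose x' : H := quomod_repr (redalg_pi x); pose y' : H := quomod_repr (redalg_pi y).
rewrite -/x' -/y'.
have hx : (x' - x : H^o) \in mspan H^o by exact/redalg_piP/redalg_piK.
have hy : (y' - y : H^o) \in mspan H^o by exact/redalg_piP/redalg_piK.
apply/redalg_piP.
have -> : x' * y' - x * y = x' * (y' - y) + (x' - x) * y.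
  by rewrite mulrBr mulrBl addrA subrK.
apply: rpredD; last exact: mspan_mulr.
exact: (@rpredZ H H^o (mspan H^o) x' _ hy).
Qed.

Lemma redalg_mulA : associative redalg_mul.
Proof.
move=> x y z; rewrite -[x]redalg_piK -[y]redalg_piK -[z]redalg_piK.
by rewrite !redalg_mulE mulrA.
Qed.
Lemma redalg_mul1r : left_id (redalg_pi 1) redalg_mul.
Proof. by move=> x; rewrite -[x]redalg_piK redalg_mulE mul1r. Qed.
Lemma redalg_mulr1 : right_id (redalg_pi 1) redalg_mul.
Proof. by move=> x; rewrite -[x]redalg_piK redalg_mulE mulr1. Qed.
Lemma redalg_mulDl : left_distributive redalg_mul +%R.
Proof.
move=> x y z; rewrite -[x]redalg_piK -[y]redalg_piK -[z]redalg_piK.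
by rewrite -redalg_piD !redalg_mulE mulrDl redalg_piD.
Qed.
Lemma redalg_mulDr : right_distributive redalg_mul +%R.
Proof.
move=> x y z; rewrite -[x]redalg_piK -[y]redalg_piK -[z]redalg_piK.
by rewrite -redalg_piD !redalg_mulE mulrDr redalg_piD.
Qed.

HB.instance Definition _ := GRing.Zmodule_isPzRing.Build redalg
  redalg_mulA redalg_mul1r redalg_mulr1 redalg_mulDl redalg_mulDr.

Section RedModule.
Variable X : lmodType H.

Definition redmod : Type := quomod (mspan X).
HB.instance Definition _ := GRing.Zmodule.on redmod.

Definition redmod_pi (x : X) : redmod := quomod_pi (mspan X) x.

Lemma redmod_piK (q : redmod) :
  redmod_pi (quomod_repr q) = q.
Proof. exact: quomod_piK. Qed.

Lemma redmod_piD x y : redmod_pi (x + y) = redmod_pi x + redmod_pi y.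
Proof. exact: quomod_piD. Qed.

Definition redmod_scale (p : redalg) (q : redmod) : redmod :=
  redmod_pi ((quomod_repr p : H)
             *: (quomod_repr q : X)).

Lemma redmod_scaleE h x :
  redmod_scale (redalg_pi h) (redmod_pi x) = redmod_pi (h *: x).
Proof.
rewrite /redmod_scale; pose h' : H := quomod_repr (redalg_pi h); pose x' : X := quomod_repr (redmod_pi x).
rewrite -/h' -/x'.
have hh : (h' - h : H^o) \in mspan H^o by exact/redalg_piP/redalg_piK.
have hx : x' - x \in mspan X by exact/quomod_piP/redmod_piK.
apply/quomod_piP.
have -> : h' *: x' - h *: x = h' *: (x' - x) + (h' - h) *: x.
  by rewrite scalerBr scalerBl addrA subrK.
apply: rpredD; last exact: mspan_act.
exact: rpredZ.
Qed.

Lemma redmod_scaleA a b v :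
  redmod_scale a (redmod_scale b v) = redmod_scale (a * b) v.
Proof.
rewrite -[v]redmod_piK -[a]redalg_piK -[b]redalg_piK.
by rewrite [_ * _]redalg_mulE !redmod_scaleE scalerA.
Qed.
Lemma redmod_scale1 : left_id 1 redmod_scale.
Proof. by move=> v; rewrite -[v]redmod_piK redmod_scaleE scale1r. Qed.
Lemma redmod_scaleDr : right_distributive redmod_scale +%R.
Proof.
move=> a u v; rewrite -[u]redmod_piK -[v]redmod_piK -[a]redalg_piK.
by rewrite -redmod_piD !redmod_scaleE scalerDr redmod_piD.
Qed.
Lemma redmod_scaleDl v : {morph redmod_scale^~ v : a b / a + b}.
Proof.
move=> a b; rewrite -[v]redmod_piK -[a]redalg_piK -[b]redalg_piK.
by rewrite -redalg_piD !redmod_scaleE scalerDl redmod_piD.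
Qed.

HB.instance Definition _ := GRing.Zmodule_isLmodule.Build redalg redmod
  redmod_scaleA redmod_scale1 redmod_scaleDr redmod_scaleDl.

End RedModule.
End Reduction.

Section ScalarExtension.
Variables (A K : comNzRingType) (iota : {rmorphism A -> K}) (H : algType A).

Definition balanced (X : lmodType H) (Y : zmodType) (g : K -> X -> Y) : Prop :=
  [/\ forall b b' x, g (b + b') x = g b x + g b' x,
      forall b x x', g b (x + x') = g b x + g b x'
    & forall b a x, g (b * iota a) x = g b (a%:A *: x)].

Definition tens_val (X : lmodType H) (Y : zmodType) (g : K -> X -> Y)
  (s : seq (K * X)) : Y := \sum_(p <- s) g p.1 p.2.

(* A list stands for the sum of the pure tensors b (x) x of its entries; two
   lists define the same element of K (x)_A X iff every balanced map takes
   the same value on them. *)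
Definition tens_eq (X : lmodType H) (s t : seq (K * X)) : bool :=
  `[< forall (Y : zmodType) (g : K -> X -> Y), balanced g ->
        tens_val g s = tens_val g t >].

Definition tens_act (X : lmodType H) (s : seq (K * H)) (t : seq (K * X)) :
    seq (K * X) :=
  [seq (p.1 * q.1, p.2 *: q.2) | p <- s, q <- t].

Lemma tens_val_act (X : lmodType H) (Y : zmodType) (g : K -> X -> Y) s t :
  tens_val g (tens_act s t) =
  \sum_(p <- s) \sum_(q <- t) g (p.1 * q.1) (p.2 *: q.2).
Proof. by rewrite /tens_val big_allpairs_dep. Qed.

Lemma tens_val_cat (X : lmodType H) (Y : zmodType) (g : K -> X -> Y) s t :
  tens_val g (s ++ t) = tens_val g s + tens_val g t.
Proof. exact: big_cat. Qed.

Lemma balanced_actl (X : lmodType H) (Y : zmodType) (g : K -> X -> Y)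
    (c : K) (h : H) :
  balanced g -> balanced (fun b (x : X) => g (c * b) (h *: x)).
Proof.
case=> gl gr gm; split=> [b b' x|b x x'|b a x].
- by rewrite mulrDr gl.
- by rewrite scalerDr gr.
- by rewrite mulrA gm !scalerA mulr_algl mulr_algr.
Qed.

Lemma balanced_actr (X : lmodType H) (Y : zmodType) (g : K -> X -> Y)
    (c : K) (x : X) :
  balanced g -> balanced (fun b (h : H^o) => g (b * c) ((h : H) *: x)).
Proof.
case=> gl gr gm; split=> [b b' h|b h h'|b a h].
- by rewrite mulrDl gl.
- by rewrite scalerDl gr.
- by rewrite mulrAC gm !scalerA.
Qed.

Section Tensor.
Variable X : lmodType H.

Lemma tens_eq_equiv : equiv_class_of (@tens_eq X).
Proof.
split=> [s|s t|t s u].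
- by apply/asboolP.
- by apply/asboolP/asboolP => e Y g bg; rewrite e.
- by move=> /asboolP e /asboolP e'; apply/asboolP => Y g bg; rewrite e ?e'.
Qed.
Canonical tens_equiv := EquivRelPack tens_eq_equiv.
Canonical tens_encModRel := defaultEncModRel (@tens_eq X).

Definition tens : Type := {eq_quot @tens_eq X}.
HB.instance Definition _ := Choice.on tens.

Definition tens_pi (s : seq (K * X)) : tens := \pi_{eq_quot @tens_eq X} s.
Definition tens_repr (v : tens) : seq (K * X) :=
  repr (v : {eq_quot @tens_eq X}).

Lemma tens_piK v : tens_pi (tens_repr v) = v.
Proof. exact: reprK. Qed.

Lemma tens_piP s t : (tens_pi s = tens_pi t) <->
  (forall (Y : zmodType) (g : K -> X -> Y), balanced g ->
     tens_val g s = tens_val g t).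
Proof.
split=> [/eqmodP/asboolP //|e].
by apply/eqmodP/asboolP.
Qed.

Lemma tens_val_repr (Y : zmodType) (g : K -> X -> Y) s : balanced g ->
  tens_val g (tens_repr (tens_pi s)) = tens_val g s.
Proof. by move: Y g; apply/tens_piP; rewrite tens_piK. Qed.

Definition tens_add (v w : tens) : tens := tens_pi (tens_repr v ++ tens_repr w).
Definition tens_opp (v : tens) : tens :=
  tens_pi [seq (- p.1, p.2) | p <- tens_repr v].

Lemma tens_addE s t : tens_add (tens_pi s) (tens_pi t) = tens_pi (s ++ t).
Proof. by apply/tens_piP => Y g bg; rewrite !tens_val_cat !tens_val_repr. Qed.

Lemma tens_addA : associative tens_add.
Proof.
move=> u v w; rewrite -[u]tens_piK -[v]tens_piK -[w]tens_piK !tens_addE.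
by rewrite catA.
Qed.
Lemma tens_addC : commutative tens_add.
Proof.
by move=> u v; apply/tens_piP => Y g bg; rewrite !tens_val_cat addrC.
Qed.
Lemma tens_add0 : left_id (tens_pi [::]) tens_add.
Proof. by move=> u; rewrite -[u]tens_piK tens_addE. Qed.
Lemma tens_addN : left_inverse (tens_pi [::]) tens_opp tens_add.
Proof.
move=> u; rewrite -{2}[u]tens_piK tens_addE.
apply/tens_piP => Y g bg; rewrite tens_val_cat /tens_val big_map big_nil.
rewrite -big_split big1 // => p _ /=; case: bg => gl _ _.
rewrite -gl addNr.
by apply: (addrI (g 0 p.2)); rewrite -gl !addr0.
Qed.

HB.instance Definition _ :=
  GRing.isZmodule.Build tens tens_addA tens_addC tens_add0 tens_addN.

Lemma tens_piD s t : tens_pi (s ++ t) = tens_pi s + tens_pi t.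
Proof. by rewrite -tens_addE. Qed.

End Tensor.

Lemma tens_act_eq (X : lmodType H) (s s' : seq (K * H^o)) (t t' : seq (K * X)) :
  tens_pi s = tens_pi s' -> tens_pi t = tens_pi t' ->
  tens_pi (tens_act s t) = tens_pi (tens_act s' t').
Proof.
move=> /tens_piP es /tens_piP et; apply/tens_piP => Y g bg.
rewrite !tens_val_act.
transitivity (\sum_(p <- s) \sum_(q <- t') g (p.1 * q.1) ((p.2 : H) *: q.2)).
  apply: eq_bigr => p _; exact: et (balanced_actl p.1 (p.2 : H) bg).
rewrite exchange_big [RHS]exchange_big; apply: eq_bigr => q _ /=.
exact: es (balanced_actr q.1 q.2 bg).
Qed.

Lemma tens_actA (X : lmodType H) (s t : seq (K * H)) (u : seq (K * X)) :
  tens_pi (tens_act s (tens_act t u)) =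
  tens_pi (tens_act (tens_act s (t : seq (K * H^o))) u).
Proof.
apply/tens_piP => Y g bg; rewrite !tens_val_act big_allpairs_dep.
apply: eq_bigr => p _; rewrite [LHS]big_allpairs_dep.
apply: eq_bigr => q _; apply: eq_bigr => r _ /=.
by rewrite mulrA scalerA.
Qed.

Lemma tens_act1 (X : lmodType H) (u : seq (K * X)) :
  tens_act [:: (1, 1)] u = u.
Proof.
rewrite /tens_act /= cats0 -[RHS]map_id; apply: eq_map => -[b x] /=.
by rewrite mul1r scale1r.
Qed.

Definition extalg : Type := tens H^o.
HB.instance Definition _ := GRing.Zmodule.on extalg.

Definition extalg_mul (v w : extalg) : extalg :=
  tens_pi (tens_act (tens_repr v : seq (K * H)) (tens_repr w)).

Lemma extalg_mulE (s t : seq (K * H^o)) :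
  extalg_mul (tens_pi s) (tens_pi t) = tens_pi (tens_act s t).
Proof. by apply: tens_act_eq; rewrite tens_piK. Qed.

Definition extalg_one : extalg := tens_pi [:: (1, 1 : H^o)].

Lemma extalg_mulA : associative extalg_mul.
Proof.
move=> u v w; rewrite -[u]tens_piK -[v]tens_piK -[w]tens_piK.
rewrite [X in extalg_mul _ X = _]extalg_mulE.
rewrite [X in _ = extalg_mul X _]extalg_mulE.
rewrite [LHS]extalg_mulE [RHS]extalg_mulE; exact: tens_actA.
Qed.
Lemma extalg_mul1r : left_id extalg_one extalg_mul.
Proof. by move=> u; rewrite -[u]tens_piK extalg_mulE tens_act1. Qed.
Lemma extalg_mulr1 : right_id extalg_one extalg_mul.
Proof.
move=> u; rewrite -[u]tens_piK extalg_mulE; congr tens_pi.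
elim: (tens_repr u) => [//|[b x] s IH].
by rewrite /tens_act /= in IH *; rewrite IH mulr1 -[x *: 1]/(x * 1) mulr1.
Qed.
Lemma extalg_mulDl : left_distributive extalg_mul +%R.
Proof.
move=> u v w; rewrite -[u]tens_piK -[v]tens_piK -[w]tens_piK.
rewrite -tens_piD !extalg_mulE -tens_piD; apply/tens_piP => Y g bg.
by rewrite tens_val_cat !tens_val_act big_cat.
Qed.
Lemma extalg_mulDr : right_distributive extalg_mul +%R.
Proof.
move=> u v w; rewrite -[u]tens_piK -[v]tens_piK -[w]tens_piK.
rewrite -tens_piD !extalg_mulE -tens_piD; apply/tens_piP => Y g bg.
rewrite tens_val_cat !tens_val_act -big_split; apply: eq_bigr => p _.
by rewrite big_cat.
Qed.

HB.instance Definition _ := GRing.Zmodule_isPzRing.Build extalg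
  extalg_mulA extalg_mul1r extalg_mulr1 extalg_mulDl extalg_mulDr.

Section ExtModule.
Variable X : lmodType H.

Definition extmod : Type := tens X.
HB.instance Definition _ := GRing.Zmodule.on extmod.

Definition extmod_scale (v : extalg) (w : extmod) : extmod :=
  tens_pi (tens_act (tens_repr v : seq (K * H)) (tens_repr w)).

Lemma extmod_scaleE (s : seq (K * H^o)) (t : seq (K * X)) :
  extmod_scale (tens_pi s) (tens_pi t) = tens_pi (tens_act s t).
Proof. by apply: tens_act_eq; rewrite tens_piK. Qed.

Lemma extmod_scaleA a b v :
  extmod_scale a (extmod_scale b v) = extmod_scale (a * b) v.
Proof.
rewrite -[v]tens_piK -[a]tens_piK -[b]tens_piK.
rewrite [X in extmod_scale _ X = _]extmod_scaleE.
rewrite [X in _ = extmod_scale X _]extalg_mulE.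
rewrite [LHS]extmod_scaleE [RHS]extmod_scaleE; exact: tens_actA.
Qed.
Lemma extmod_scale1 : left_id 1 extmod_scale.
Proof. by move=> v; rewrite -[v]tens_piK extmod_scaleE tens_act1. Qed.
Lemma extmod_scaleDr : right_distributive extmod_scale +%R.
Proof.
move=> u v w; rewrite -[u]tens_piK -[v]tens_piK -[w]tens_piK.
rewrite -tens_piD !extmod_scaleE -tens_piD; apply/tens_piP => Y g bg.
rewrite tens_val_cat !tens_val_act -big_split; apply: eq_bigr => p _.
by rewrite big_cat.
Qed.
Lemma extmod_scaleDl w : {morph extmod_scale^~ w : u v / u + v}.
Proof.
move=> u v; rewrite -[u]tens_piK -[v]tens_piK -[w]tens_piK.
rewrite -tens_piD !extmod_scaleE -tens_piD; apply/tens_piP => Y g bg.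
by rewrite tens_val_cat !tens_val_act big_cat.
Qed.

HB.instance Definition _ := GRing.Zmodule_isLmodule.Build extalg extmod
  extmod_scaleA extmod_scale1 extmod_scaleDr extmod_scaleDl.

End ExtModule.
End ScalarExtension.

(* Q(t), as the field of fractions of Z[t]. *)
Definition Kt : fieldType := {fraction {poly int}}.

Definition laurent_pred : Kt -> bool := fun x =>
  `[< exists (p : {poly int}) (n : nat),
        x = FracField.tofrac p / FracField.tofrac 'X ^+ n >].

Lemma tX_neq0 n : FracField.tofrac ('X : {poly int}) ^+ n != 0.
Proof. by rewrite expf_eq0 tofrac_eq0 polyX_eq0 andbF. Qed.

Lemma laurent_closed : GRing.subring_closed (laurent_pred : {pred Kt}).
Proof.
split.
- by apply/asboolP; exists 1, 0%N; rewrite tofrac1 expr0 divr1.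
- move=> _ _ /asboolP[p [n ->]] /asboolP[q [m ->]]; apply/asboolP.
  exists (p * 'X ^+ m - q * 'X ^+ n), (n + m)%N.
  rewrite -mulNr addf_div ?tX_neq0 // -exprD; congr (_ / _).
  by rewrite tofracB !tofracM !tofracXn mulNr.
- move=> _ _ /asboolP[p [n ->]] /asboolP[q [m ->]]; apply/asboolP.
  by exists (p * q), (n + m)%N; rewrite mulf_div -exprD tofracM.
Qed.
HB.instance Definition _ :=
  GRing.isSubringClosed.Build Kt laurent_pred laurent_closed.

Definition Zt : Type := {x : Kt | x \in laurent_pred}.
HB.instance Definition _ := SubType.on Zt.
HB.instance Definition _ := Choice.on Zt.
HB.instance Definition _ := [SubChoice_isSubComNzRing of Zt by <:].

Definition ZtK : {rmorphism Zt -> Kt} := \val.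

Lemma t_laurent : FracField.tofrac 'X \in laurent_pred.
Proof. by apply/asboolP; exists 'X, 0%N; rewrite divr1. Qed.
Lemma tinv_laurent : (FracField.tofrac 'X)^-1 \in laurent_pred.
Proof. by apply/asboolP; exists 1, 1%N; rewrite tofrac1 expr1 div1r. Qed.

Definition tvar : Zt := Sub (FracField.tofrac 'X) t_laurent.
Definition tvarV : Zt := Sub (FracField.tofrac 'X)^-1 tinv_laurent.

Lemma tvar_tvarV : tvar * tvarV = 1.
Proof. by apply: val_inj; rewrite /= mulfV // -[X in X != 0]expr1 tX_neq0. Qed.

(* The element t^-1 p(t^-1) of t^-1 Z[t^-1]. *)
Definition tneg (p : {poly int}) : Zt := tvarV * (map_poly intr p).[tvarV].

Section Coxeter.
Variables (W : finGroupType) (S : {set W}).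

(* The last clause is the universal property of the presentation of W by S and
   the relations (st)^m(s,t) = 1, where m(s,t) is the order of st. *)
Definition coxeter_system : Prop :=
  [/\ 1%g \notin S,
      {in S, forall s, (s * s = 1)%g},
      <<S>>%g = [set: W]
    & forall (G : groupType) (f : W -> G),
        {in S &, forall s s', ((f s * f s') ^+ #[s * s'])%g = 1%g} ->
        exists g : W -> G, {morph g : x y / (x * y)%g} /\ {in S, g =1 f}].

(* phi induces the isomorphism from N / (B :&: N) onto W.  The last clause, B =
   U ><| (B :&: N) and so on, is the splitting in characteristic p that the BN-pair
   of a finite group of Lie type has. *)
Definition split_BN_pair (p : nat) (G : finGroupType) (B N : {group G})
    (phi : {morphism N >-> W}) : Prop :=
  [/\ (B <*> N)%g = [set: G],
      (phi @* N)%g = [set: W] /\ ('ker phi)%g = B :&: N,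
      forall n m, n \in N -> m \in N -> phi n \in S ->
        ([set n] * B * [set m] \subset
           B * [set m] * B :|: B * [set n * m] * B)%g,
      forall n, n \in N -> phi n \in S -> (B :^ n)%g != B
    & exists U : {group G},
        [/\ (p.-group U)%g, (U ><| (B :&: N))%g = B, abelian (B :&: N),
            (p^'.-group (B :&: N))%g
          & \bigcap_(n in N) (B :^ n)%g = B :&: N]].

(* (W, S) and c come from a family of finite groups of Lie type G(q), one for
   each prime power q.  Suzuki and Ree groups, which exist only in
   characteristics 2 and 3, form no such family. *)
Definition lie_type_parameters (c : W -> nat) : Prop :=
  (forall s, s \in S -> (0 < c s)%N) /\
  forall p k, prime p -> (0 < k)%N ->
    exists (G : finGroupType) (B N : {group G}) (phi : {morphism N >-> W}),
      split_BN_pair p B phi /\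
      forall n, n \in N -> phi n \in S ->
        #|B : (B :^ n^-1) :&: B|%g = ((p ^ k) ^ c (phi n))%N.

Definition length (w : W) : nat :=
  @classical_sets.xget nat 0%N
    (fun n => w \in (S ^+ n)%g /\ forall k, w \in (S ^+ k)%g -> (n <= k)%N).

Definition reduced_word (w : W) : seq W :=
  @classical_sets.xget (seq W) [::]
    (fun s => [/\ all (mem S) s, (\prod_(x <- s) x)%g = w & size s = length w]).

(* The strong Bruhat order: (s ^ w)%g ranges over the reflections. *)
Definition bruhat_step (x y : W) : bool :=
  [exists s in S, [exists w : W,
     (y == x * s ^ w)%g && (length x < length y)%N]].

Definition bruhat_lt (x y : W) : bool := (x != y) && connect bruhat_step x y.

End Coxeter.

Section Hecke.
Variables (W : finGroupType) (S : {set W}) (c : W -> nat).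
Variable H : algType Zt.

Definition hecke_basis (T : W -> H) : Prop :=
  [/\ forall h : H, exists! a : {ffun W -> Zt}, h = \sum_w a w *: T w,
      T 1%g = 1
  & forall s w, s \in S ->
    (bruhat_lt S w (s * w)%g -> T s * T w = T (s * w)%g) /\
    (bruhat_lt S (s * w)%g w ->
       T s * T w = tvar ^+ (2 * c s) *: T (s * w)%g + (tvar ^+ (2 * c s) - 1) *: T w)].

Definition weight (w : W) : nat := (\sum_(s <- reduced_word S w) c s)%N.

Definition tildeT (T : W -> H) (w : W) : H := tvarV ^+ weight w *: T w.

(* The involution t |-> t^-1, tilde T_x |-> (tilde T_(x^-1))^-1. *)
Definition bar_involution (T : W -> H) (bar : {rmorphism H -> H}) : Prop :=
  [/\ bar tvar%:A = tvarV%:A, involutive bar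
    & forall x, bar (tildeT T x) * tildeT T x^-1%g = 1 /\
                tildeT T x^-1%g * bar (tildeT T x) = 1].

Definition kl_basis (T C : W -> H) : Prop :=
  exists2 bar : {rmorphism H -> H}, bar_involution T bar &
    forall w, bar (C w) = C w /\
      exists p : W -> {poly int},
        C w = tildeT T w + \sum_(y | bruhat_lt S y w) tneg (p y) *: tildeT T y.

Section Cells.
Variable C : W -> H.

(* The C_y form a basis, so the coefficients are unique. *)
Definition occurs (x : W) (h : H) : bool :=
  `[< exists2 a : W -> Zt, h = \sum_y a y *: C y & a x != 0 >].

Definition leL : rel W :=
  connect (fun x y => [exists s in S, occurs x (C s * C y)]).
Definition leLR : rel W :=
  connect (fun x y => [exists s in S,
                         occurs x (C s * C y) || occurs x (C y * C s)]).

Definition eqL (x y : W) : bool := leL x y && leL y x.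
Definition eqLR (x y : W) : bool := leLR x y && leLR y x.

Definition left_cells : {set {set W}} := [set [set y | eqL x y] | x : W].
Definition two_sided_cells : {set {set W}} := [set [set y | eqLR x y] | x : W].

Definition left_cell : Type := {o : {set W} | o \in left_cells}.
Definition two_sided_cell : Type := {o : {set W} | o \in two_sided_cells}.

Lemma leLR_of_leL x y : leL x y -> leLR x y.
Proof.
apply: connect_sub => {}x {}y /exists_inP[s sS o]; apply: connect1.
by apply/exists_inP; exists s => //; rewrite o.
Qed.

Lemma leLR_trans y x z : leLR x y -> leLR y z -> leLR x z.
Proof. exact: connect_trans. Qed.

Lemma cell_of_proof (o : left_cell) :
  [set y | [exists x in val o, eqLR x y]] \in two_sided_cells.
Proof.
case: o => _ /= /imsetP[x _ ->]; apply/imsetP; exists x => //.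
apply/setP => y; rewrite !inE; apply/exists_inP/idP => [[z]|exy]; last first.
  by exists x => //; rewrite inE /eqL /leL !connect0.
rewrite inE => /andP[/leLR_of_leL xz /leLR_of_leL zx] /andP[zy yz].
by rewrite /eqLR (leLR_trans xz zy) (leLR_trans yz zx).
Qed.

Definition cell_of (o : left_cell) : two_sided_cell :=
  exist (fun G : {set W} => G \in two_sided_cells) _ (cell_of_proof o).

Definition leLR_op (o o' : left_cell) : bool :=
  [exists x in val o, [exists y in val o', leLR y x]].

Definition height_compatible (ht : left_cell -> nat) : Prop :=
  (forall o o', leLR_op o o' -> cell_of o <> cell_of o' -> (ht o < ht o')%N) /\
  (forall o o', cell_of o = cell_of o' -> ht o = ht o').

Definition cspan (P : pred W) : {pred H^o} := fun h =>
  `[< exists a : W -> Zt, h = \sum_(x | P x) a x *: C x >].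

Definition below (G : two_sided_cell) : pred W :=
  fun x => [exists y in val G, leLR x y].
Definition strictly_below (G : two_sided_cell) : pred W :=
  fun x => below G x && (x \notin val G).

End Cells.
End Hecke.

Section CellModule.
Variables (W : finGroupType) (S : {set W}) (c : W -> nat).
Variable H : algType Zt.
Variables (T C : W -> H).
Hypothesis cox : coxeter_system S.
Hypothesis heckeT : hecke_basis S c T.
Hypothesis klC : kl_basis S c T C.

Lemma length_mem w : w \in (S ^+ length S w)%g /\
  forall k, w \in (S ^+ k)%g -> (length S w <= k)%N.
Proof.
rewrite /length; case: classical_sets.xgetP => [n _ //|none].
have: w \in <<S>>%g by case: cox => _ _ -> _; rewrite inE.
move=> /gen_prodgP[n [f fS defw]].
have ex : exists n, w \in (S ^+ n)%g.
  exists n; rewrite defw; elim: n f fS {defw} => [|n IH] f fS.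
    by rewrite big_ord0 expg0 inE.
  by rewrite big_ord_recl expgS mem_mulg // IH.
case: (ex_minnP ex) => k kw kmin; case: (none k); split=> // j; exact: kmin.
Qed.

Lemma length_eq0 w : length S w = 0%N -> w = 1%g.
Proof. by have [] := length_mem w => + _ e; rewrite e expg0 => /set1P. Qed.

Lemma length_gen s : s \in S -> (length S s <= 1)%N.
Proof. by have [_ m] := length_mem s => sS; apply: m; rewrite expg1. Qed.

Lemma bruhat_length x y : bruhat_lt S x y -> (length S x < length S y)%N.
Proof.
case/andP => ne /connectP[q]; elim: q x ne => [|z q IH] x ne /=.
  by move=> _ e; rewrite e eqxx in ne.
case/andP=> /exists_inP[s _ /existsP[w /andP[_ lt]]] pq ey.
have [ezy|nezy] := eqVneq z y; first by rewrite -ezy.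
exact: ltn_trans lt (IH z nezy pq ey).
Qed.

Lemma split_gen w : w != 1%g ->
  exists s w', [/\ s \in S, w = (s * w')%g, bruhat_lt S w' w
                 & (length S w' < length S w)%N].
Proof.
move=> nw; have [mw _] := length_mem w.
case e: (length S w) mw => [|n] mw.
  by rewrite (length_eq0 e) eqxx in nw.
move: mw; rewrite expgS => /mulsgP[s w' sS w'n def].
have lt : (length S w' < n.+1)%N by rewrite ltnS; apply: (length_mem w').2.
exists s, w'; split=> //; rewrite /bruhat_lt; apply/andP; split.
  by apply: contraTneq lt => ->; rewrite e ltnn.
apply: connect1; apply/exists_inP; exists s => //.
apply/existsP; exists w'; rewrite e lt andbT def.
by rewrite conjgE mulKVg.
Qed.

Lemma tildeT_span w : exists a : W -> Zt, tildeT S c T w = \sum_x a x *: C x.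
Proof.
have [n] := ubnP (length S w); elim: n w => // n IH w ltn.
have [bar _ /(_ w)[_ [p defC]]] := klC.
have ex y : exists a : W -> Zt,
    bruhat_lt S y w -> tildeT S c T y = \sum_x a x *: C x.
  case E: (bruhat_lt S y w); last by exists (fun=> 0).
  have [|a ->] := IH y; last by exists a.
  exact: leq_trans (bruhat_length E) _.
have [b bP] := choice ex.
have -> : tildeT S c T w = C w -
    \sum_(y | bruhat_lt S y w) tneg (p y) *: tildeT S c T y.
  by rewrite defC addrK.
exists (fun x => (x == w)%:R -
    \sum_(y | bruhat_lt S y w) tneg (p y) * b y x).
under [RHS]eq_bigr do rewrite scalerBl scaler_suml.
rewrite sumrB; congr (_ - _).
  rewrite (bigD1 w) //= eqxx scale1r big1 ?addr0 // => x /negPf ->.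
  by rewrite scale0r.
rewrite exchange_big; apply: eq_bigr => y lt /=.
rewrite (bP y lt) scaler_sumr; apply: eq_bigr => x _; by rewrite scalerA.
Qed.

Lemma C_span h : exists a : W -> Zt, h = \sum_x a x *: C x.
Proof.
have [/(_ h)[a [-> _]] _ _] := heckeT.
have [b bP] := choice tildeT_span.
exists (fun x => \sum_w a w * tvar ^+ weight S c w * b w x).
under [RHS]eq_bigr do rewrite scaler_suml.
rewrite exchange_big; apply: eq_bigr => w _ /=.
under eq_bigr do rewrite -scalerA.
rewrite -scaler_sumr -bP /tildeT scalerA -mulrA -exprMn tvar_tvarV expr1n.
by rewrite mulr1.
Qed.

Lemma T_gen s : s \in S -> exists a b : Zt, T s = a *: C s + b *: 1.
Proof.
move=> sS; have [bar _ /(_ s)[_ [p defC]]] := klC.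
have [_ T1 _] := heckeT.
exists (tvar ^+ weight S c s).
suff [b ->] : exists b : Zt, C s = tildeT S c T s + b *: 1.
  exists (- (tvar ^+ weight S c s * b)).
  rewrite scalerDr scaleNr -scalerA addrK /tildeT scalerA -exprMn tvar_tvarV.
  by rewrite expr1n scale1r.
rewrite defC; have [l1|l1] := boolP (bruhat_lt S 1%g s); last first.
  exists 0; rewrite scale0r big1 // => y /[dup] lt /bruhat_length ly.
  case/negP: l1; suff <- : y = 1%g by [].
  by apply: length_eq0; move: (leq_trans ly (length_gen sS)); case: (length S y).
exists (tneg (p 1%g) * tvarV ^+ weight S c 1%g); congr (_ + _).
rewrite (bigD1 1%g) //= big1 ?addr0 => [|y /andP[/bruhat_length ly /eqP[]]].
  by rewrite /tildeT T1 scalerA.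
by apply: length_eq0; move: (leq_trans ly (length_gen sS)); case: (length S y).
Qed.

Lemma cspan_sum (P : pred W) (I : Type) (r : seq I) (Q : pred I) (F : I -> H) :
  (forall i, Q i -> F i \in cspan C P) -> \sum_(i <- r | Q i) F i \in cspan C P.
Proof.
move=> FP; apply: (big_ind (fun h : H => h \in cspan C P)) => //;
  last first.
  move=> _ _ /asboolP[a ->] /asboolP[b ->]; apply/asboolP.
  exists (fun x => a x + b x).
  by rewrite -big_split; apply: eq_bigr => x _; rewrite scalerDl.
apply/asboolP; exists (fun=> 0); rewrite big1 // => x _; exact: scale0r.
Qed.

Lemma cspanZ P (a : Zt) (h : H) : h \in cspan C P -> a *: h \in cspan C P.
Proof.
move=> /asboolP[b ->]; apply/asboolP; exists (fun x => a * b x).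
by rewrite scaler_sumr; apply: eq_bigr => x _; rewrite scalerA.
Qed.

Lemma cspanD P (h k : H) :
  h \in cspan C P -> k \in cspan C P -> h + k \in cspan C P.
Proof.
move=> hP kP; have := @cspan_sum P bool [:: true; false] predT
  (fun b => if b then h else k).
by rewrite !big_cons big_nil addr0 => -> // -[].
Qed.

Lemma cspan_closed (P : pred W) :
  (forall x y, leL S C x y -> P y -> P x) -> submod_closed (cspan C P).
Proof.
move=> Pdown.
have CsC s x : s \in S -> P x -> C s * C x \in cspan C P.
  move=> sS Px; have [a def] := C_span (C s * C x).
  apply/asboolP; exists a; rewrite [LHS]def [RHS]big_mkcond.
  apply: eq_bigr => y _; case: ifPn => // nPy.
  suff -> : a y = 0 by rewrite scale0r.
  apply/eqP; apply: contraNT nPy => ay; apply: Pdown Px; apply: connect1.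
  by apply/exists_inP; exists s => //; apply/asboolP; exists a.
have TsI s h : s \in S -> h \in cspan C P -> T s * h \in cspan C P.
  move=> sS hP; have [a [b ->]] := T_gen sS.
  rewrite mulrDl -!scalerAl mul1r; apply: cspanD; apply: cspanZ => //.
  move: hP => /asboolP[d ->]; rewrite mulr_sumr; apply: cspan_sum => x Px.
  by rewrite -scalerAr; apply: cspanZ; apply: CsC.
have TwI w h : h \in cspan C P -> T w * h \in cspan C P.
  have [_ T1 rel] := heckeT.
  have [n] := ubnP (length S w); elim: n w h => // n IH w h ltn hP.
  have [->|/split_gen[s [w' [sS def lt ltl]]]] := eqVneq w 1%g.
    by rewrite T1 mul1r.
  rewrite def -(proj1 (rel s w' sS)) -?def // -mulrA; apply: TsI => //.
  by apply: IH => //; exact: leq_trans ltl _.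
split=> [|h x y xP yP].
  apply/asboolP; exists (fun=> 0); rewrite big1 // => x _; exact: scale0r.
apply: cspanD => //; rewrite -[h *: x]/(h * x).
have [/(_ h)[a [-> _]] _ _] := heckeT.
rewrite mulr_suml; apply: cspan_sum => w _.
by rewrite -scalerAl; apply: cspanZ; apply: TwI.
Qed.

Lemma below_down (G : two_sided_cell S C) x y :
  leL S C x y -> below G y -> below G x.
Proof.
move=> /leLR_of_leL xy /exists_inP[z zG yz].
by apply/exists_inP; exists z => //; exact: leLR_trans xy yz.
Qed.

Lemma strictly_below_down (G : two_sided_cell S C) x y :
  leL S C x y -> strictly_below G y -> strictly_below G x.
Proof.
move=> xy /andP[yG nyG]; rewrite /strictly_below (below_down xy yG) /=.
apply: contra nyG => xG; move: yG xG => /exists_inP[z].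
case: G => _ /= /imsetP[u _ ->]; rewrite !inE => /andP[uz zu] yz /andP[ux xu].
have xy' := leLR_of_leL xy.
by rewrite /eqLR (leLR_trans ux xy') (leLR_trans yz zu).
Qed.

Definition cell_module (G : two_sided_cell S C) : lmodType H :=
  factor (mk_submod (cspan_closed (@below_down G)))
         (mk_submod (cspan_closed (@strictly_below_down G))).

End CellModule.

(* Main.v *)
From HB Require Import structures.
Require Import Defs.
From mathcomp Require Import all_boot all_order all_algebra all_fingroup.
From mathcomp Require Import boolp.
From mathcomp Require classical_sets.

Set Implicit Arguments.
Unset Strict Implicit.
Unset Printing Implicit Defensive.

(* For a two-sided cell G let I_G (resp. J_G) be the two-sided ideal of H
   spanned by the C_x with x below (resp. strictly below) G, so that
   S[G] = I_G / J_G.  Pull an irreducible module D of a base change of H back to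
   H, and pick G minimal for <=_LR with I_G D <> 0.  Then J_G D = 0, so for a
   suitable d in D the map i |-> i d induces a nonzero homomorphism from the base
   change of S[G] to D; hence D is in the head of S[G].  Conversely, if D is a
   composition factor of the reduction of S[G'], then I_G does not annihilate
   S[G'].  As I_G I_G' is contained in the intersection of I_G and I_G', which
   lies in J_G' unless G' <=_LR G, the cell G' is below G.  So G is the only cell
   of minimal height whose module contains D. *)

Import GRing.Theory.
Local Open Scope ring_scope.

(** * Composition series, heads and finite length over an arbitrary ring *)

Section Modules.
Variable R : pzRingType.
Implicit Types V D : lmodType R.

Definition mk_linear V D (f : V -> D) (hf : linear f) : {linear V -> D} :=
  HB.pack_for {linear V -> D} f (GRing.isLinear.Build R V D *:%R f hf).

Lemma quomod_pi_linear V (U : submodClosed V) : linear (quomod_pi U).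
Proof.
by move=> a x y; rewrite quomod_piD -[quomod_pi U (a *: x)]quomod_scaleE.
Qed.

Lemma quomod_pi0 V (U : submodClosed V) x : (quomod_pi U x = 0) <-> (x \in U).
Proof.
have e0 : quomod_pi U 0 = 0.
  exact: (raddf0 (mk_linear (@quomod_pi_linear V U))).
by rewrite -e0; split=> [/quomod_piP|h]; [|apply/quomod_piP]; rewrite subr0.
Qed.

Lemma quomod_lift V D (U : submodClosed V) (f : {linear V -> D}) :
  (forall x, x \in U -> f x = 0) ->
  exists g : {linear quomod U -> D}, forall x, g (quomod_pi U x) = f x.
Proof.
move=> f0; pose g (q : quomod U) := f (quomod_repr q).
have gE x : g (quomod_pi U x) = f x.
  apply/eqP; rewrite -subr_eq0 -raddfB; apply/eqP/f0/quomod_piP.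
  exact: quomod_piK.
suff gl : linear g by exists (mk_linear gl).
move=> a p q; rewrite -[p]quomod_piK -[q]quomod_piK -quomod_pi_linear !gE.
exact: linearP.
Qed.

Definition to_submod V (U : submodClosed V) x (xU : x \in U) : submod U :=
  exist (fun x => x \in U) x xU.

Lemma ker_closed V D (f : {linear V -> D}) :
  submod_closed ([pred x | f x == 0] : {pred V}).
Proof.
split=> [|a x y]; rewrite !inE ?raddf0 // => /eqP fx /eqP fy.
by rewrite linearP fx fy scaler0 addr0.
Qed.

Definition ker_mod V D (f : {linear V -> D}) : submodClosed V :=
  mk_submod (ker_closed f).

Lemma in_ker_mod V D (f : {linear V -> D}) x : (x \in ker_mod f) = (f x == 0).
Proof. by []. Qed.

Section Image.
Variables (V D : lmodType R) (f : {linear V -> D}) (U : submodClosed V).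

Definition im_pred : {pred D} := fun d => `[< exists2 x, x \in U & d = f x >].

Lemma im_closed : submod_closed im_pred.
Proof.
split=> [|a d d' /asboolP[x xU ->] /asboolP[y yU ->]]; apply/asboolP.
  by exists 0; rewrite ?rpred0 ?raddf0.
by exists (a *: x + y); rewrite ?linearP // rpredD ?rpredZ.
Qed.

Definition im_mod : submodClosed D := mk_submod im_closed.

Lemma im_modP d : reflect (exists2 x, x \in U & d = f x) (d \in im_mod).
Proof. exact: asboolP. Qed.
End Image.

Lemma top_closed V : submod_closed (predT : {pred V}).
Proof. by split. Qed.
Definition top_mod V : submodClosed V := mk_submod (@top_closed V).

Lemma zero_closed V : submod_closed (pred1 0 : {pred V}).
Proof.
by split=> [|a x y]; rewrite !inE // => /eqP-> /eqP->; rewrite scaler0 addr0.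
Qed.
Definition zero_mod V : submodClosed V := mk_submod (@zero_closed V).

Lemma schur V D (f : {linear V -> D}) x :
  simple_mod V -> simple_mod D -> f x != 0 -> bijective f.
Proof.
move=> [_ sV] [_ sD] fx.
have inj : injective f.
  have [k0 y z eyz|kT] := sV (ker_mod f); last first.
    by move: (kT x); rewrite in_ker_mod (negPf fx).
  apply/eqP; rewrite -subr_eq0; apply/eqP/k0.
  by rewrite in_ker_mod linearB /= eyz subrr.
have surj d : exists y, f y = d.
  have [i0|iT] := sD (im_mod f (top_mod V)).
    by move/eqP: fx; case; apply: i0; apply/im_modP; exists x.
  by have /im_modP[y _ ->] := iT d; exists y.
have [g gK] := choice surj.
by exists g => // y; apply: inj; rewrite gK.
Qed.

(** The image of [U] is zero or all of [D], and injectivity carries either case back to [U]. This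
    makes the quotient by the kernel of a map to [D] semisimple. *)
Lemma inj_simple_sub V D (f : {linear V -> D}) : injective f -> simple_mod D ->
  forall U : submodClosed V,
    (forall x, x \in U -> x = 0) \/ (forall x, x \in U).
Proof.
move=> inj [_ sD] U; have [i0|iT] := sD (im_mod f U); [left|right] => x.
  move=> xU; apply: inj; rewrite raddf0; apply: i0; apply/im_modP; by exists x.
by have /im_modP[y yU /inj->] := iT (f x).
Qed.

(** [comp_mult] has the default value 0 on modules without a composition series, so a multiplicity
    can be shown nonzero only once this holds. *)
Definition finite_length V : Prop :=
  exists n (F : nat -> submodClosed V), composition_series n F.

(** In any composition series, take the first term on which [f] does not vanish: [f] induces a
    nonzero map from its factor to [D], an isomorphism by Schur's lemma. *)
Lemma comp_mult_quotient V D (f : {linear V -> D}) x :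
  finite_length V -> simple_mod D -> f x != 0 -> comp_mult V D <> 0%N.
Proof.
move=> [n0 [F0 cs0]] sD fx.
rewrite /comp_mult; case: classical_sets.xgetP => [_ ->|none]; last first.
  by case: (none _ (ex_intro _ n0 (ex_intro _ F0 (conj cs0 erefl)))).
move=> [n [F [[F_0 Fn Fs] ->]]].
pose P i := `[< exists2 y, y \in F i & f y != 0 >].
have exP : exists i, P i by exists n; apply/asboolP; exists x.
case: (ex_minnP exP) => -[|i] /asboolP[y yF fy] mini.
  by move: fy; rewrite (F_0 _ yF) raddf0 eqxx.
have lein : (i < n)%N.
  by apply: mini; apply/asboolP; exists x.
have fF0 z : z \in F i -> f z = 0.
  move=> zF; apply/eqP; apply: contraT => fz.
  by have := mini i; rewrite ltnn => -> //; apply/asboolP; exists z.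
apply/eqP; rewrite -lt0n card_gt0; apply/set0Pn; exists (Ordinal lein).
rewrite inE; apply/asboolP.
have fl : linear (f \o val : submod (F i.+1) -> D).
  by move=> a u v; rewrite /= -linearP.
have [|g gE] := @quomod_lift _ _
  (mk_submod (restr_closed (F i.+1) (F i))) (mk_linear fl).
  by move=> z zF; apply: fF0.
exists g; have [_ sF] := Fs i lein.
have := @schur _ _ g (quomod_pi _ (to_submod yF)) sF sD.
apply; by rewrite gE.
Qed.

(** A nonzero multiplicity rules out the default value, so [D] is isomorphic to a subquotient of
    [V], and [r] kills every subquotient. *)
Lemma comp_mult_annihilator V D (r : R) : comp_mult V D <> 0%N ->
  (forall v : V, r *: v = 0) -> forall d : D, r *: d = 0.
Proof.
rewrite /comp_mult; case: classical_sets.xgetP => [_ ->|//].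
move=> [n [F [_ ->]]] /eqP; rewrite -lt0n card_gt0 => /set0Pn[i].
rewrite inE => /asboolP[f [g gK fK]] r0 d.
suff q0 q : r *: q = 0 :> factor (F i.+1) (F i).
  by rewrite -[d]fK -linearZ q0 raddf0.
rewrite -[q]quomod_piK; set y := quomod_repr q.
rewrite -[LHS]/(quomod_scale r (quomod_pi _ y)) quomod_scaleE.
apply/quomod_pi0; have -> : r *: y = 0 by apply: val_inj; rewrite /= r0.
exact: rpred0.
Qed.

(** The quotient of [V] by the kernel of [f] embeds in the simple module [D], so it is semisimple.
    The kernel therefore contains that of the head, and [f] factors through the head. *)
Lemma head_quotient V D (f : {linear V -> D}) x :
  finite_length (Defs.head V) -> simple_mod D -> f x != 0 -> in_head V D.
Proof.
move=> fl sD fx; pose K := ker_mod f.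
have [z zK|g gE] := @quomod_lift _ _ K f.
  by apply/eqP; rewrite -in_ker_mod.
have ginj : injective g.
  move=> p q; rewrite -[p]quomod_piK -[q]quomod_piK !gE => e.
  by apply/quomod_piP; rewrite in_ker_mod linearB /= e subrr.
have ss : semisimple_mod (quomod K).
  move=> U; have [U0|UT] := inj_simple_sub ginj sD U.
    exists (top_mod _); split=> [y yU _|y]; first exact: U0.
    by exists 0; rewrite ?rpred0.
  exists (zero_mod _); split=> [y _|y]; first by rewrite inE => /eqP.
  by exists y; rewrite // subrr inE.
have [z /asboolP zK|g' g'E] := @quomod_lift _ _
  (mk_submod (@head_kernel_closed R V)) f.
  by apply/eqP; rewrite -in_ker_mod; apply: zK.
apply: (@comp_mult_quotient _ _ g' (quomod_pi _ x)) => //.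
by rewrite g'E.
Qed.

Lemma factor_simple V (U U1 : submodClosed V) x :
  {subset U <= U1} -> x \in U1 -> x \notin U ->
  (forall X : submodClosed V, {subset U <= X} -> {subset X <= U1} ->
     {subset X <= U} \/ {subset U1 <= X}) ->
  simple_mod (factor U1 U).
Proof.
move=> sUU1 xU1 xU mx; split.
  exists (quomod_pi _ (to_submod xU1)); apply/eqP => /quomod_pi0 e.
  by move/negP: xU; apply.
move=> Y.
pose M := mk_submod (restr_closed U1 U).
pose X : {pred V} := fun v =>
  `[< exists2 y : submod U1, quomod_pi M y \in Y & v = val y >].
have Xc : submod_closed X.
  split=> [|a u v /asboolP[y yY ->] /asboolP[z zY ->]]; apply/asboolP.
    exists 0; rewrite ?raddf0 //.
    by rewrite (quomod_pi0 _ 0).2 ?rpred0.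
  by exists (a *: y + z) => //; rewrite quomod_pi_linear rpredD ?rpredZ.
have [||XU|U1X] := mx (mk_submod Xc).
- move=> u uU; apply/asboolP; exists (to_submod (sUU1 u uU)) => //.
  by rewrite (quomod_pi0 _ _).2 ?rpred0.
- by move=> _ /asboolP[y _ ->]; apply: valP.
- left=> q; rewrite -[q]quomod_piK => qY.
  apply/quomod_pi0; apply: XU; apply/asboolP; by exists (quomod_repr q).
- right=> q; rewrite -[q]quomod_piK.
  have /asboolP[y yY /val_inj->] := U1X _ (valP (quomod_repr q)).
  exact: yY.
Qed.

(** Above each proper submodule choose a strictly larger one of least measure: nothing lies strictly
    between, so the factor is simple. The bound on [mu] makes the resulting chain reach [V]. *)
Lemma finite_length_of_measure V (n : nat) (mu : submodClosed V -> nat) :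
  (forall U, (mu U <= n)%N) ->
  (forall (U U1 : submodClosed V) x, {subset U <= U1} ->
     x \in U1 -> x \notin U ->
     (mu U < mu U1)%N) ->
  finite_length V.
Proof.
move=> mun mus.
have nextP (U : submodClosed V) : exists U1 : submodClosed V,
    (forall x, x \in U) /\ (forall x, x \in U1) \/
    [/\ {subset U <= U1}, (mu U < mu U1)%N & simple_mod (factor U1 U)].
  (* At the top the chain is made stationary, so that [next] is defined on every submodule. *)
  have [UT|nT] := EM (forall x, x \in U); first by exists U; left.
  have [x /negP xU] : exists x, ~ x \in U by apply/existsNP.
  pose P k := `[< exists U1 : submodClosed V, [/\ {subset U <= U1},
       (exists2 y, y \in U1 & y \notin U) & mu U1 = k] >].
  have exP : exists k, P k.
    exists (mu (top_mod V)); apply/asboolP; exists (top_mod V).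
    by split=> //; exists x.
  case: (ex_minnP exP) => k /asboolP[U1 [sUU1 [y yU1 yU] <-]] mink.
  exists U1; right; split=> //; first exact: mus yU1 yU.
  apply: (factor_simple sUU1 yU1 yU) => X sUX sXU1.
  have [|/existsNP[z /not_implyP[zX /negP zU]]] := EM {subset X <= U}.
    by left.
  right; apply: contrapT => /existsNP[v /not_implyP[vU1 /negP vX]].
  have := mus _ _ _ sXU1 vU1 vX; rewrite ltnNge mink //.
  by apply/asboolP; exists X; split=> //; exists z.
have [next nP] := choice nextP.
pose F i := iter i next (zero_mod V).
have Fmu i : (forall x, x \in F i) \/ (i <= mu (F i))%N.
  elim: i => [|i IH]; first by right.
  case: (nP (F i)) => [[_ FT]|[_ lt _]]; first by left.
  case: IH => [FT|le]; last by right; apply: leq_ltn_trans le lt.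
  by left=> x; case: (nP (F i)) => [[_]|[s _ _]]; [apply|apply: s].
pose P k := `[< forall x, x \in F k >].
have exP : exists k, P k.
  exists n.+1; apply/asboolP; case: (Fmu n.+1) => // /leq_trans/(_ (mun _)).
  by rewrite ltnn.
(* With the least such [k], no step before [k] is stationary. *)
case: (ex_minnP exP) => k /asboolP Fk mink.
exists k, F; split=> // [x|i ltik]; first by rewrite inE => /eqP.
case: (nP (F i)) => [[FT _]|[? _ ?]] //.
by have := mink i; rewrite leqNgt ltik => /(_ (asboolT FT)).
Qed.

(* Call k a pivot of U if U contains a combination of e_0, ..., e_k whose k-th
   coefficient acts nontrivially.  By Gaussian elimination a larger submodule
   has more pivots, even though the e_i may be dependent. *)
Lemma finite_length_of_span V (A : comNzRingType) (phi : A -> R) (I : finType)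
    (e : I -> V) :
  (forall a b c (v : V),
     phi (a - c * b) *: v = phi a *: v - phi c *: (phi b *: v)) ->
  (forall a b, (forall v : V, phi b *: v = 0) \/
     exists c, forall v : V, phi a *: v = phi c *: (phi b *: v)) ->
  (forall v, exists a : I -> A, v = \sum_i phi (a i) *: e i) ->
  finite_length V.
Proof.
(* [phiV] says that the values of [phi] act on [V] like elements of a field: each acts as zero or
   divides every other. This covers both reduction modulo a maximal ideal and extension to a
   field. *)
move=> phiB phiV span.
pose e' k := oapp (fun i : 'I_#|I| => e (enum_val i)) 0 (insub k).
have span' v : exists a : nat -> A, v = \sum_(k < #|I|) phi (a k) *: e' k.
  have [a ->] := span v.
  exists (fun k => oapp (fun i : 'I_#|I| => a (enum_val i)) 0 (insub k)).
  rewrite (reindex _ (onW_bij _ (enum_val_bij I))); apply: eq_bigr => i _.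
  by rewrite /e' valK.
pose piv (U : submodClosed V) k := `[< exists a : nat -> A,
  \sum_(j < k.+1) phi (a j) *: e' j \in U /\
    ~ forall v : V, phi (a k) *: v = 0 >].
pose mu U := #|[set i : 'I_#|I| | piv U i]|.
apply: (@finite_length_of_measure V #|I| mu) => [U|U U1 x sUU1 xU1 xU].
  by rewrite /mu -[leqRHS]card_ord max_card.
have sp : [set i : 'I_#|I| | piv U i] \subset [set i : 'I_#|I| | piv U1 i].
  apply/subsetP => i; rewrite !inE => /asboolP[a [aU na]]; apply/asboolP.
  by exists a; split=> //; apply: sUU1.
apply: proper_card; rewrite properEneq sp andbT; apply: contra xU => /eqP epiv.
(* [U] and [U1] are now assumed to have the same pivots. The case [k = #|I|] puts [x] in [U],
   against its choice. *)
suff key k (a : nat -> A) : (k <= #|I|)%N ->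
    \sum_(j < k) phi (a j) *: e' j \in U1 ->
    \sum_(j < k) phi (a j) *: e' j \in U.
  by have [a ax] := span' x; rewrite ax key // -ax.
elim: k a => [|k IH] a lek aU1; first by rewrite big_ord0 rpred0.
have [a0|na] := EM (forall v : V, phi (a k) *: v = 0).
  move: aU1; rewrite big_ord_recr /= a0 addr0; apply: IH; exact: ltnW.
have : Ordinal lek \in [set i : 'I_#|I| | piv U i].
  by rewrite epiv inE; apply/asboolP; exists a.
rewrite inE => /asboolP[b [/= bU nb]].
(* [b] realizes the pivot [k] inside [U]; subtracting [c] times its combination cancels the [k]-th
   term and leaves a shorter combination in [U1]. *)
have [//|[c cE]] := phiV (a k) (b k).
have eS : \sum_(j < k) phi (a j - c * b j) *: e' j =
    \sum_(j < k.+1) phi (a j) *: e' j -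
    phi c *: \sum_(j < k.+1) phi (b j) *: e' j.
  rewrite [in RHS]big_ord_recr [X in _ - _ *: X]big_ord_recr /= scalerDr -cE.
  rewrite opprD addrACA subrr addr0 scaler_sumr -sumrB.
  by apply: eq_bigr => j _; rewrite phiB.
rewrite -[X in X \in U](subrK (phi c *: \sum_(j < k.+1) phi (b j) *: e' j)) -eS.
apply: rpredD; last exact: rpredZ.
apply: (IH (fun j => a j - c * b j) (ltnW lek)); rewrite eS -scaleNr.
apply: rpredD => //; apply: rpredZ.
exact: sUU1.
Qed.
End Modules.

(* A surjective endomorphism of a free module of finite rank is injective. *)
Lemma spanning_free (A : comPzRingType) (V : lmodType A) (I : finType)
    (T C : I -> V) :
  (forall v, exists! a : {ffun I -> A}, v = \sum_i a i *: T i) ->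
  (forall i, exists a : I -> A, T i = \sum_j a j *: C j) ->
  forall a b : I -> A, \sum_i a i *: C i = \sum_i b i *: C i -> a =1 b.
Proof.
move=> basT spanC.
have T_inj (a b : I -> A) : \sum_i a i *: T i = \sum_i b i *: T i -> a =1 b.
  have [u [_ u_uniq]] := basT (\sum_i a i *: T i) => eab i.
  have ua : u = finfun a by apply: u_uniq; apply: eq_bigr => j _; rewrite ffunE.
  have ub : u = finfun b.
    by apply: u_uniq; rewrite eab; apply: eq_bigr => j _; rewrite ffunE.
  have := congr1 (fun f : {ffun I -> A} => f i) (etrans (esym ua) ub).
  by rewrite !ffunE.
have [P TP] := choice spanC.
have exQ j : exists q : I -> A, C j = \sum_i q i *: T i.
  by have [a [-> _]] := basT (C j); exists a.
have [Q CQ] := choice exQ.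
have sumCE (a : I -> A) :
    \sum_j a j *: C j = \sum_i (\sum_j a j * Q j i) *: T i.
  under [RHS]eq_bigr do rewrite scaler_suml.
  rewrite exchange_big; apply: eq_bigr => j _ /=.
  by rewrite CQ scaler_sumr; apply: eq_bigr => i _; rewrite scalerA.
(* Independence of the [T i] makes the product of the transition matrices [MP] and [MQ] the
   identity. Over a commutative ring the reverse product is then the identity too, and this gives
   independence of the [C i]. *)
pose MP := \matrix_(i < #|I|, j < #|I|) P (enum_val i) (enum_val j).
pose MQ := \matrix_(i < #|I|, j < #|I|) Q (enum_val i) (enum_val j).
have PQ : MP *m MQ = 1%:M.
  apply/matrixP => i k; rewrite !mxE.
  under eq_bigr do rewrite !mxE.
  rewrite -(big_enum_val (fun j => P (enum_val i) j * Q j (enum_val k))) /=.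
  have := @T_inj (fun k => \sum_j P (enum_val i) j * Q j k)
                 (fun k => (enum_val i == k)%:R) _ (enum_val k).
  rewrite (inj_eq enum_val_inj) => -> //.
  rewrite -sumCE -TP (bigD1 (enum_val i)) //= eqxx scale1r big1 ?addr0 // => j.
  by rewrite eq_sym => /negPf->; rewrite scale0r.
have QP j k : \sum_i Q j i * P i k = (j == k)%:R.
  have /matrixP/(_ (enum_rank j) (enum_rank k)) := mulmx1C PQ.
  rewrite !mxE (inj_eq enum_rank_inj) => <-.
  under [RHS]eq_bigr do rewrite !mxE !enum_rankK.
  by rewrite -(big_enum_val (fun i => Q j i * P i k)).
have recover (a : I -> A) k : \sum_i (\sum_j a j * Q j i) * P i k = a k.
  under eq_bigr do rewrite mulr_suml.
  rewrite exchange_big (bigD1 k) //= [X in _ + X]big1 => [|j /negPf jk].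
    by under eq_bigr do rewrite -mulrA; rewrite -mulr_sumr QP eqxx mulr1 addr0.
  by under eq_bigr do rewrite -mulrA; rewrite -mulr_sumr QP jk mulr0.
move=> a b; rewrite !sumCE => /T_inj eab k.
by rewrite -(recover a) -(recover b); apply: eq_bigr => i _; rewrite eab.
Qed.

(** * Ideals spanned by Kazhdan-Lusztig elements, and cell modules *)

Section Cells.
Variables (W : finGroupType) (S : {set W}) (c : W -> nat).
Variables (H : algType Zt) (T C : W -> H).
Hypothesis cox : coxeter_system S.
Hypothesis heckeT : hecke_basis S c T.
Hypothesis klC : kl_basis S c T C.

Lemma C_free (a b : W -> Zt) :
  \sum_x a x *: C x = \sum_x b x *: C x -> a =1 b.
Proof.
have [basT _ _] := heckeT.
apply: (@spanning_free _ H _ T C basT) => w; exact: (C_span heckeT klC).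
Qed.

(** Expansions in the [C x] are unique, so the coefficients of [h] vanish outside [P] and outside
    [Q]. *)
Lemma cspanI (P Q : pred W) h :
  h \in cspan C P -> h \in cspan C Q -> h \in cspan C (predI P Q).
Proof.
move=> /asboolP[a ha] /asboolP[b hb]; apply/asboolP; exists a; rewrite ha.
rewrite [LHS]big_mkcond [RHS]big_mkcond; apply: eq_bigr => x _ /=.
case Px: (P x) => //=; case Qx: (Q x) => //=.
have := @C_free (fun x => if P x then a x else 0)
                (fun x => if Q x then b x else 0) _ x.
rewrite Px Qx => ->; first by rewrite scale0r.
transitivity h.
  rewrite ha [RHS]big_mkcond.
  by apply: eq_bigr => y _; case: ifP; rewrite ?scale0r.
rewrite hb [LHS]big_mkcond.
by apply: eq_bigr => y _; case: ifP; rewrite ?scale0r.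
Qed.

(** The right-hand counterpart of [cspan_closed]; together they make the span a two-sided ideal. *)
Lemma cspan_mulr (P : pred W) :
  (forall x y, leLR S C x y -> P y -> P x) ->
  forall h k : H, h \in cspan C P -> h * k \in cspan C P.
Proof.
move=> Pdown.
have CCs s x : s \in S -> P x -> C x * C s \in cspan C P.
  move=> sS Px; have [a def] := C_span heckeT klC (C x * C s).
  apply/asboolP; exists a; rewrite [LHS]def [RHS]big_mkcond.
  apply: eq_bigr => y _; case: ifPn => // nPy.
  suff -> : a y = 0 by rewrite scale0r.
  apply/eqP; apply: contraNT nPy => ay; apply: Pdown Px; apply: connect1.
  apply/exists_inP; exists s => //; apply/orP; right.
  by apply/asboolP; exists a.
have ITs s h : s \in S -> h \in cspan C P -> h * T s \in cspan C P.
  move=> sS hP; have [a [b ->]] := T_gen cox heckeT klC sS.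
  rewrite mulrDr -!scalerAr mulr1; apply: cspanD; apply: cspanZ => //.
  move: hP => /asboolP[d ->]; rewrite mulr_suml; apply: cspan_sum => x Px.
  by rewrite -scalerAl; apply: cspanZ; apply: CCs.
have ITw w h : h \in cspan C P -> h * T w \in cspan C P.
  have [_ T1 rel] := heckeT.
  have [n] := ubnP (length S w); elim: n w h => // n IH w h ltn hP.
  have [->|/(split_gen cox)[s [w' [sS def lt ltl]]]] := eqVneq w 1%g.
    by rewrite T1 mulr1.
  (* Splitting off the first letter puts [T s] next to [h], so the induction hypothesis is applied
     to [h * T s]. *)
  rewrite def -(proj1 (rel s w' sS)) -?def // mulrA; apply: IH; last exact: ITs.
  exact: leq_trans ltl _.
move=> h k hP; have [/(_ k)[a [-> _]] _ _] := heckeT.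
rewrite mulr_sumr; apply: cspan_sum => w _.
by rewrite -scalerAr; apply: cspanZ; apply: ITw.
Qed.

Local Notation Cell := (two_sided_cell S C).
Local Notation mod G := (cell_module cox heckeT klC G).

Lemma cell_eqLR (G : Cell) x y : x \in val G -> (y \in val G) = eqLR S C x y.
Proof.
case: G => _ /= /imsetP[u _ ->]; rewrite !inE => /andP[ux xu].
apply/andP/andP => -[p q]; split.
- exact: leLR_trans xu p.
- exact: leLR_trans q ux.
- exact: leLR_trans ux p.
- exact: leLR_trans q xu.
Qed.

(** The generators are the classes of the [C w] with [w] below [G]; for other [w] the value of [e]
    is arbitrary and gets coefficient 0. Finite length of the base changes follows from this. *)
Lemma cell_module_span (G : Cell) : exists e : W -> mod G,
  forall q, exists a : W -> Zt, q = \sum_w (a w)%:A *: e w.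
Proof.
pose N := mk_submod (cspan_closed cox heckeT klC (below_down (G := G))).
have exe w : exists y : submod N, below G w -> val y = C w.
  have [Gw|_] := boolP (below G w); last by exists 0.
  have CwN : C w \in N.
    apply/asboolP; exists (fun x => (x == w)%:R).
    rewrite (bigD1 w) //= eqxx scale1r big1 ?addr0 // => x /andP[_ /negPf->].
    exact: scale0r.
  by exists (to_submod CwN).
have [e eP] := choice exe.
exists (fun w => quomod_pi _ (e w)) => q.
have /asboolP[a qa] := valP (quomod_repr q).
exists (fun w => if below G w then a w else 0).
pose pil := mk_linear (@quomod_pi_linear _ _ (mk_submod (restr_closed N
  (mk_submod (cspan_closed cox heckeT klC (strictly_below_down (G := G))))))).
have -> : q = pil (\sum_w (if below G w then a w else 0)%:A *: e w).
  rewrite -[LHS]quomod_piK; congr (pil _); apply: val_inj.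
  rewrite [LHS]qa raddf_sum [LHS]big_mkcond; apply: eq_bigr => w _ /=.
  case: ifP => [Gw|_]; last by rewrite scale0r scale0r.
  by rewrite eP // -[RHS]/(_%:A * C w) -scalerAl mul1r.
rewrite raddf_sum; apply: eq_bigr => w _; exact: (esym (quomod_scaleE _ _ _)).
Qed.

(** Multiplication by [h] sends the span below [G'] into its intersection with the ideal of [G]. An
    element below both cells is not in [G'], so it is strictly below [G'] and vanishes in the
    quotient. *)
Lemma cell_module_annihilator (G G' : Cell) (h : H) : h \in cspan C (below G) ->
  (forall x, x \in val G' -> ~~ below G x) -> forall q : mod G', h *: q = 0.
Proof.
move=> hG nG'G q; rewrite -[q]quomod_piK; set y := quomod_repr q.
rewrite -[LHS]/(quomod_scale h (quomod_pi _ y)) quomod_scaleE.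
apply/quomod_pi0.
have yG' : h * (val y : H) \in cspan C (below G').
  pose N := mk_submod (cspan_closed cox heckeT klC (below_down (G := G'))).
  exact: (@rpredZ H H^o N h (val y) (valP y)).
have yG : h * (val y : H) \in cspan C (below G).
  apply: cspan_mulr => // x z xz /exists_inP[u uG zu]; apply/exists_inP.
  by exists u => //; apply: leLR_trans xz zu.
have /asboolP[a ha] := cspanI yG yG'.
apply/asboolP; exists (fun x => if below G x then a x else 0).
rewrite [LHS]ha big_mkcond [RHS]big_mkcond; apply: eq_bigr => x _ /=.
rewrite /strictly_below; case Gx: (below G x); case G'x: (below G' x) => //=.
  by rewrite (contraTN (nG'G x)) ?Gx.
by case: ifP; rewrite // scale0r.
Qed.

(** * The leading cell of a module over a base change *)

Section Leading.
Variables (R : pzRingType) (D : lmodType R) (psi : {rmorphism H -> R}).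

(** As 1 is a combination of the [C x], some [C x] acts nontrivially on [D]. Take one with the
    fewest elements below [x]: anything strictly below has fewer still, so it acts as zero. The map
    [psi] stands for either base change of [H]. *)
Lemma leading_cell (d : D) : d != 0 -> exists o : left_cell S C,
  (exists h (d' : D), h \in cspan C (below (cell_of o)) /\ psi h *: d' != 0) /\
  (forall h (d' : D), h \in cspan C (strictly_below (cell_of o)) ->
     psi h *: d' = 0).
Proof.
move=> dn0; pose P x := `[< exists d' : D, psi (C x) *: d' != 0 >].
have psi_cspan (Q : pred W) h : (forall x, Q x -> ~~ P x) -> h \in cspan C Q ->
    forall d' : D, psi h *: d' = 0.
  move=> QP /asboolP[a ->] d'; rewrite rmorph_sum scaler_suml big1 // => x /QP.
  move=> /asboolP nP; rewrite -mulr_algl rmorphM /= -scalerA.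
  have -> : psi (C x) *: d' = 0.
    by apply/eqP/negP => /negP e; apply: nP; exists d'.
  exact: scaler0.
have [x0 Px0] : exists x, P x.
  apply: contrapT => nP; move/eqP: dn0; apply.
  rewrite -[d]scale1r -(rmorph1 psi); apply: (psi_cspan predT).
    by move=> x _; apply/negP => Px; apply: nP; exists x.
  by have [a ->] := C_span heckeT klC 1; apply/asboolP; exists a.
case: (arg_minnP (fun x => #|[set y | leLR S C y x]|) Px0) => x Px minx.
have oP : [set y | eqL S C x y] \in left_cells S C by apply/imsetP; exists x.
pose o : left_cell S C := exist (fun o : {set W} => o \in left_cells S C) _ oP.
have xo : x \in val (cell_of o).
  rewrite inE; apply/exists_inP.
  by exists x; rewrite ?inE /eqL /eqLR /leL /leLR !connect0.
exists o; split.
  have /asboolP[d' d'P] := Px; exists (C x), d'; split=> //.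
  apply/asboolP; exists (fun y => (y == x)%:R).
  rewrite (bigD1 x) /=; last first.
    by apply/exists_inP; exists x => //; exact: connect0.
  rewrite eqxx scale1r big1 ?addr0 // => y /andP[_ /negPf->]; exact: scale0r.
move=> h d' hG; apply: psi_cspan hG d' => y /andP[/exists_inP[z zo yz] ny].
have yx : leLR S C y x.
  move: zo; rewrite (cell_eqLR _ xo) => /andP[_ zx]; exact: leLR_trans yz zx.
apply/negP => /minx; rewrite leqNgt => /negP; apply.
(* [x] is below itself but not below [y], since [y] is outside its cell. *)
apply: proper_card; apply/properP; split.
  by apply/subsetP => u; rewrite !inE => uy; apply: leLR_trans uy yx.
exists x; rewrite inE ?connect0 //; first exact: connect0.
by move: ny; rewrite (cell_eqLR _ xo) /eqLR yx andbT.
Qed.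

(** Letting elements of the ideal of [G] act on [d] gives a map that vanishes on the strictly lower
    ideal. It is only [psi]-semilinear, and becomes linear after base change. *)
Lemma cell_module_map (G : Cell) (h : H) (d : D) :
  h \in cspan C (below G) -> psi h *: d != 0 ->
  (forall k (d' : D), k \in cspan C (strictly_below G) -> psi k *: d' = 0) ->
  exists g : mod G -> D, [/\ {morph g : p q / p + q},
    forall k q, g (k *: q) = psi k *: g q & exists q, g q != 0].
Proof.
move=> hG hd J0; pose g (q : mod G) := psi (val (quomod_repr q) : H) *: d.
pose pi y : mod G := quomod_pi _ y.
have gE y : g (pi y) = psi (val y : H) *: d.
  apply/eqP; rewrite -subr_eq0 -scalerBl -rmorphB; apply/eqP/J0.
  have /quomod_piP : pi (quomod_repr (pi y)) = pi y by exact: quomod_piK.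
  by [].
have pil : linear pi := @quomod_pi_linear _ _ _.
exists g; split.
- move=> p q; rewrite -[p]quomod_piK -[q]quomod_piK -quomod_piD !gE.
  by rewrite -scalerDl -rmorphD.
- move=> k q; rewrite -[q]quomod_piK.
  rewrite -[k *: _]/(quomod_scale k (quomod_pi _ _)) quomod_scaleE !gE.
  by rewrite scalerA -rmorphM.
have hN : (h : H^o) \in
  mk_submod (cspan_closed cox heckeT klC (below_down (G := G))) by [].
by exists (pi (to_submod hN)); rewrite gE.
Qed.
End Leading.

End Cells.

(** * Reduction modulo an ideal of the base ring *)

Section Reduction.
Variables (A : comNzRingType) (H : algType A) (m : {pred A}).

Lemma redalg_pi_zmod : zmod_morphism (redalg_pi m : H -> redalg H m).
Proof. exact: (raddfB (mk_linear (@quomod_pi_linear _ _ (mspan m H^o)))). Qed.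

Lemma redalg_pi_monoid : monoid_morphism (redalg_pi m : H -> redalg H m).
Proof. by split=> // x y; rewrite [RHS]redalg_mulE. Qed.

Definition redalg_rmorph : {rmorphism H -> redalg H m} :=
  HB.pack_for {rmorphism H -> redalg H m} (redalg_pi m)
    (GRing.isZmodMorphism.Build H (redalg H m) (redalg_pi m) redalg_pi_zmod)
    (GRing.isMonoidMorphism.Build H (redalg H m) (redalg_pi m)
      redalg_pi_monoid).

Lemma redalg_pi_scalar0 a : a \in m -> redalg_rmorph a%:A = 0.
Proof.
move=> am; rewrite -(rmorph0 redalg_rmorph); apply/redalg_piP; rewrite subr0.
apply/asboolP; exists [:: (a, 1)]; rewrite /= ?am // big_seq1.
by rewrite -[RHS]/(_ * _) mulr1.
Qed.

(** Elements of [m] act as zero on [D], so a semilinear [g] kills the submodule [mspan m X]. *)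
Lemma redmod_lift (X : lmodType H) (D : lmodType (redalg H m)) (g : X -> D) :
  {morph g : x y / x + y} ->
  (forall h x, g (h *: x) = redalg_rmorph h *: g x) ->
  exists f : {linear redmod m X -> D}, forall x, f (redmod_pi m x) = g x.
Proof.
move=> gD gZ; have g0 : g 0 = 0 by apply: (addrI (g 0)); rewrite -gD !addr0.
have gN x : g (- x) = - g x by rewrite -scaleN1r gZ rmorphN1 scaleN1r.
have gm x : x \in mspan m X -> g x = 0.
  move=> /asboolP[s sm ->]; elim: s sm => [|p s IH] /=.
    by rewrite big_nil.
  move=> /andP[pm sm]; rewrite big_cons gD gZ redalg_pi_scalar0 //.
  by rewrite scale0r add0r IH.
pose f (q : redmod m X) := g (quomod_repr q).
have fE x : f (redmod_pi m x) = g x.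
  apply/eqP; rewrite -subr_eq0 -gN -gD; apply/eqP/gm/quomod_piP.
  exact: redmod_piK.
suff fl : linear f by exists (mk_linear fl).
move=> a p q; rewrite -[a]redalg_piK -[p]redmod_piK -[q]redmod_piK.
by rewrite [_ *: redmod_pi m _]redmod_scaleE -redmod_piD !fE gD gZ.
Qed.

Lemma redmod_annihilator (X : lmodType H) (h : H) :
  (forall x : X, h *: x = 0) -> forall v : redmod m X, redalg_rmorph h *: v = 0.
Proof.
move=> h0 v; rewrite -[v]redmod_piK [LHS]redmod_scaleE h0.
by apply/quomod_pi0; rewrite rpred0.
Qed.

Hypothesis max_m : maximal_ideal m.

Lemma maximal_inverse a : a \notin m -> exists b, a * b - 1 \in m.
Proof.
case: max_m => -[m0 m1 mD] maxm am; apply: contrapT => nb; case/negP: am.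
(* [J] is the ideal generated by [m] and [a]. Being [idealr_closed] includes properness, which for
   [J] is the assumption that [a] has no inverse modulo [m]. *)
pose J : {pred A} := fun x => `[< exists2 b, x - a * b \in m & True >].
apply: (maxm J).
- split=> [||h x y /asboolP[b xb _] /asboolP[b' yb _]].
  + by apply/asboolP; exists 0; rewrite // mulr0 subr0.
  + apply/negP => /asboolP[b ab _]; apply: nb; exists b.
    have := mD (-1) _ _ ab m0; by rewrite mulN1r addr0 opprB.
  + apply/asboolP; exists (h * b + b') => //.
    have -> : h * x + y - a * (h * b + b') = h * (x - a * b) + (y - a * b').
      by rewrite mulrDr mulrBr opprD addrACA [a * (h * b)]mulrCA.
    exact: mD.
- by move=> x xm; apply/asboolP; exists 0; rewrite // mulr0 subr0.
- by apply/asboolP; exists 1; rewrite // mulr1 subrr.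
Qed.

Lemma redalg_finite_length (V : lmodType (redalg H m)) (I : finType)
    (e : I -> V) :
  (forall v, exists a : I -> A, v = \sum_i redalg_rmorph (a i)%:A *: e i) ->
  finite_length V.
Proof.
apply: (@finite_length_of_span _ V A (fun a => redalg_rmorph a%:A)).
  move=> a b k v; rewrite scalerBl -[(k * b) *: 1]scalerA -mulr_algl.
  by rewrite rmorphB rmorphM scalerBl scalerA.
move=> a b; have [bm|/maximal_inverse[b' bb']] := boolP (b \in m).
  by left=> v; rewrite redalg_pi_scalar0 // scale0r.
(* [b'] inverts [b] modulo [m], so [a * b'] is the quotient of [a] by [b]. *)
right; exists (a * b') => v; rewrite scalerA -rmorphM; congr (_ *: _).
apply/eqP; rewrite -subr_eq0 -rmorphB; apply/eqP.
rewrite mulr_algl scalerA -scalerBl redalg_pi_scalar0 //.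
have [[m0 _ mD] _] := max_m.
have := mD (- a) _ _ bb' m0; rewrite addr0 mulrBr mulr1 opprK mulNr.
by rewrite addrC mulrA (mulrAC a).
Qed.

Lemma redmod_span (X : lmodType H) (I : finType) (e : I -> X) :
  (forall x, exists a : I -> A, x = \sum_i (a i)%:A *: e i) ->
  forall v : redmod m X, exists a : I -> A,
    v = \sum_i redalg_rmorph (a i)%:A *: redmod_pi m (e i).
Proof.
move=> span v; have [a ea] := span (quomod_repr v); exists a.
rewrite -[LHS]redmod_piK ea.
rewrite [LHS](raddf_sum (mk_linear (@quomod_pi_linear _ _ (mspan m X)))).
by apply: eq_bigr => i _; rewrite [RHS]redmod_scaleE.
Qed.

Lemma quomod_span (V : lmodType (redalg H m)) (U : submodClosed V)
    (I : finType) (e : I -> V) :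
  (forall x, exists a : I -> A, x = \sum_i redalg_rmorph (a i)%:A *: e i) ->
  forall q : quomod U, exists a : I -> A,
    q = \sum_i redalg_rmorph (a i)%:A *: quomod_pi U (e i).
Proof.
move=> span v; have [a ea] := span (quomod_repr v); exists a.
rewrite -[LHS]quomod_piK ea.
rewrite [LHS](raddf_sum (mk_linear (@quomod_pi_linear _ _ U))).
by apply: eq_bigr => i _; exact: (esym (quomod_scaleE _ _ _)).
Qed.

End Reduction.

(** * Extension of scalars *)

Section Extension.
Variables (A K : comNzRingType) (iota : {rmorphism A -> K}) (H : algType A).
Local Notation HK := (extalg iota H).

Definition ext_pure (b : K) (h : H) : HK := tens_pi iota [:: (b, h : H^o)].

Lemma ext_pureDl b b' h : ext_pure (b + b') h = ext_pure b h + ext_pure b' h.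
Proof.
rewrite -tens_piD; apply/tens_piP => Y g [gl _ _].
by rewrite /tens_val !big_cons !big_nil !addr0 gl.
Qed.

Lemma ext_pureDr b h h' : ext_pure b (h + h') = ext_pure b h + ext_pure b h'.
Proof.
rewrite -tens_piD; apply/tens_piP => Y g [_ gr _].
by rewrite /tens_val !big_cons !big_nil !addr0 gr.
Qed.

Lemma ext_pureM b b' h h' :
  ext_pure b h * ext_pure b' h' = ext_pure (b * b') (h * h').
Proof. by rewrite [LHS]extalg_mulE. Qed.

Lemma ext_pure_iota b a : ext_pure (b * iota a) 1 = ext_pure b a%:A.
Proof.
apply/tens_piP => Y g [_ _ gm].
by rewrite /tens_val !big_seq1 gm -[_%:A *: _]/(_ * _) mulr1.
Qed.

Lemma extmod_scale_pi (X : lmodType H) (s : seq (K * H^o)) (t : seq (K * X)) :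
  (tens_pi iota s : HK) *: (tens_pi iota t : extmod iota X) =
  tens_pi iota (tens_act s t).
Proof. exact: extmod_scaleE. Qed.

Lemma tens_pi_sum (X : lmodType H) (s : seq (K * X)) :
  tens_pi iota s = \sum_(p <- s) tens_pi iota [:: p].
Proof.
elim: s => [|p s IH]; first by rewrite big_nil.
by rewrite big_cons -IH -tens_piD.
Qed.

Lemma ext_pure1_zmod : zmod_morphism (ext_pure 1).
Proof.
have p0 : ext_pure 1 0 = 0.
  by apply: (addrI (ext_pure 1 0)); rewrite -ext_pureDr !addr0.
move=> x y; apply: (addIr (ext_pure 1 y)).
by rewrite -ext_pureDr !subrK.
Qed.

Lemma ext_pure1_monoid : monoid_morphism (ext_pure 1).
Proof. by split=> // x y; rewrite ext_pureM mulr1. Qed.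

Definition extalg_rmorph : {rmorphism H -> HK} :=
  HB.pack_for {rmorphism H -> HK} (ext_pure 1)
    (GRing.isZmodMorphism.Build H HK (ext_pure 1) ext_pure1_zmod)
    (GRing.isMonoidMorphism.Build H HK (ext_pure 1) ext_pure1_monoid).

(** The balanced map [k] sends [b] and [x] to [ext_pure b 1 *: g x]. It descends to tensors because
    their equality is tested on all balanced maps. *)
Lemma extmod_lift (X : lmodType H) (D : lmodType HK) (g : X -> D) :
  {morph g : x y / x + y} ->
  (forall h x, g (h *: x) = extalg_rmorph h *: g x) ->
  exists f : {linear extmod iota X -> D},
    forall x, f (tens_pi iota [:: (1, x)]) = g x.
Proof.
move=> gD gZ; pose k b x := ext_pure b 1 *: g x.
have bal : balanced iota k.
  split=> [b b' x|b x x'|b a x]; rewrite /k.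
  - by rewrite ext_pureDl scalerDl.
  - by rewrite gD scalerDr.
  - by rewrite gZ scalerA ext_pureM mulr1 mul1r ext_pure_iota.
pose f (v : extmod iota X) := tens_val k (tens_repr v).
have fE s : f (tens_pi iota s) = tens_val k s by exact: tens_val_repr.
have fl : linear f.
  move=> a v w; rewrite -[a]tens_piK -[v]tens_piK -[w]tens_piK.
  rewrite extmod_scale_pi -tens_piD !fE tens_val_cat tens_val_act.
  congr (_ + _); rewrite tens_pi_sum scaler_suml; apply: eq_bigr => -[b h] _.
  rewrite /tens_val scaler_sumr; apply: eq_bigr => q _.
  rewrite -[tens_pi _ _]/(ext_pure b h) /k gZ !scalerA.
  by rewrite !ext_pureM !mulr1 !mul1r.
exists (mk_linear fl) => x; rewrite [LHS]fE /tens_val big_seq1 /k /=.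
by rewrite -[ext_pure 1 1]/(1 : HK) scale1r.
Qed.
End Extension.

Section FieldExtension.
Variables (A : comNzRingType) (K : fieldType) (iota : {rmorphism A -> K}).
Variable H : algType A.

Lemma extmod_finite_length (X : lmodType H) (I : finType) (e : I -> X) :
  (forall x, exists a : I -> A, x = \sum_i (a i)%:A *: e i) ->
  finite_length (extmod iota X).
Proof.
move=> span.
apply: (@finite_length_of_span _ (extmod iota X) K
          (fun b => ext_pure iota b (1 : H)) I
          (fun i => tens_pi iota [:: (1, e i)])).
- move=> a b k v.
  have -> : ext_pure iota (a - k * b) (1 : H) =
      ext_pure iota a 1 - ext_pure iota k 1 * ext_pure iota b 1.
    rewrite ext_pureM mulr1.
    by apply: (addIr (ext_pure iota (k * b) 1)); rewrite -ext_pureDl !subrK.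
  by rewrite scalerBl scalerA.
- move=> a b; have [->|b0] := eqVneq b 0.
    left=> v; suff -> : ext_pure iota 0 (1 : H) = 0 by rewrite scale0r.
    by apply: (addrI (ext_pure iota 0 1)); rewrite -ext_pureDl !addr0.
  by right; exists (a / b) => v; rewrite scalerA ext_pureM mulr1 divfK.
move=> v; have [a aP] := choice span.
(* The coefficient at the tensor of 1 and [e i], once the second component of each pure tensor in
   [v] is expanded in the [e i]. *)
pose beta i := \sum_(p <- tens_repr v) p.1 * iota (a p.2 i).
exists beta; transitivity (tens_pi iota [seq (beta i, e i) | i <- enum I]).
  rewrite -[LHS]tens_piK; apply/tens_piP => Y g [gl gr gm].
  have g0l x : g 0 x = 0 by apply: (addrI (g 0 x)); rewrite -gl !addr0.
  have g0r b : g b 0 = 0 by apply: (addrI (g b 0)); rewrite -gr !addr0.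
  rewrite /tens_val big_map big_enum /=.
  under [RHS]eq_bigr do
    rewrite (big_morph (g^~ (e _)) (id1 := 0) (op1 := +%R)) //.
  rewrite exchange_big; apply: eq_bigr => p _ /=.
  rewrite [in LHS](aP p.2) (big_morph (g p.1) (id1 := 0) (op1 := +%R)) //.
  by apply: eq_bigr => i _; rewrite gm.
rewrite tens_pi_sum big_map big_enum /=; apply: eq_bigr => i _.
by rewrite extmod_scale_pi /tens_act /= mulr1 scale1r.
Qed.
End FieldExtension.

(** * Cells whose modules contain a given irreducible module *)

Section LeadingCell.
Variables (W : finGroupType) (S : {set W}) (c : W -> nat).
Variables (H : algType Zt) (T C : W -> H).
Hypothesis cox : coxeter_system S.
Hypothesis heckeT : hecke_basis S c T.
Hypothesis klC : kl_basis S c T C.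
Local Notation mod o := (cell_module cox heckeT klC (cell_of o)).

Lemma leLR_op_below (o v : left_cell S C) x :
  x \in val (cell_of v) -> below (cell_of o) x -> leLR_op o v.
Proof.
rewrite inE => /exists_inP[x' x'v /andP[x'x _]] /exists_inP[y].
rewrite inE => /exists_inP[y' y'o /andP[_ yy']] xy.
apply/exists_inP; exists y' => //; apply/exists_inP; exists x' => //.
exact: leLR_trans x'x (leLR_trans xy yy').
Qed.

Lemma extmod_cell_exists (E : lmodType (extalg ZtK H)) : simple_mod E ->
  exists o : left_cell S C, comp_mult (extmod ZtK (mod o)) E <> 0%N.
Proof.
move=> sE; have [[d d0] _] := sE.
have [o [[h [d' [hG hd]]] J0]] :=
  leading_cell heckeT klC (extalg_rmorph ZtK H) d0.
exists o.
have [g [gD gZ [q gq]]] := cell_module_map cox heckeT klC hG hd J0.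
have [f fE] := extmod_lift gD gZ.
apply: (@comp_mult_quotient _ _ _ f (tens_pi ZtK [:: (1, q)])) => //.
  have [e eP] := cell_module_span cox heckeT klC (cell_of o).
  exact: extmod_finite_length eP.
by rewrite fE.
Qed.

Section Reduction.
Variables (m : {pred Zt}) (max_m : maximal_ideal m).
Variables (D : lmodType (redalg H m)) (sD : simple_mod D).

Lemma redmod_leading_cell : exists o : left_cell S C,
  [/\ comp_mult (redmod m (mod o)) D <> 0%N, in_head (redmod m (mod o)) D
    & forall v, comp_mult (redmod m (mod v)) D <> 0%N -> leLR_op o v].
Proof.
have [[d d0] _] := sD.
have [o [[h [d' [hG hd]]] J0]] :=
  leading_cell heckeT klC (redalg_rmorph H m) d0.
have [g [gD gZ [q gq]]] := cell_module_map cox heckeT klC hG hd J0.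
have [f fE] := redmod_lift gD gZ.
have [e eP] := cell_module_span cox heckeT klC (cell_of o).
have fq : f (redmod_pi m q) != 0 by rewrite fE.
exists o; split.
- apply: (comp_mult_quotient _ sD fq).
  exact: (redalg_finite_length max_m (redmod_span eP)).
- apply: (head_quotient _ sD fq).
  exact: (redalg_finite_length max_m (quomod_span (redmod_span eP))).
(* If [o] were not below [v] for [leLR_op], then [h] would annihilate the module of [v] and hence
   its composition factor [D], contradicting [hd]. *)
- move=> v Dv; apply: contrapT => nov; move/eqP: hd; apply.
  apply: (comp_mult_annihilator Dv); apply: redmod_annihilator.
  apply: cell_module_annihilator hG _ => x xv; apply/negP => xo; apply: nov.
  exact: leLR_op_below xv xo.
Qed.
End Reduction.
End LeadingCell.

Local Close Scope ring_scope.

Theorem theorem6p2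
  (W : finGroupType) (S : {set W}) (c : W -> nat)
  (cox : coxeter_system S) (lie : lie_type_parameters S c)
  (H : algType Zt) (T : W -> H) (heckeT : hecke_basis S c T)
  (C : W -> H) (klC : kl_basis S c T C)
  (ht : left_cell S C -> nat) (ht_compat : height_compatible ht) :
  let cellmod (o : left_cell S C) : lmodType H :=
    cell_module cox heckeT klC (cell_of o) in
  let is_cell_of (m : {pred Zt}) (D : lmodType (redalg H m))
      (o : left_cell S C) : Prop :=
    comp_mult (redmod m (cellmod o)) D <> 0 /\
    forall v : left_cell S C, ht v <= ht o -> cell_of v <> cell_of o ->
      comp_mult (redmod m (cellmod v)) D = 0 in
  [/\ forall E : lmodType (extalg ZtK H), simple_mod E ->
        exists o : left_cell S C, comp_mult (extmod ZtK (cellmod o)) E <> 0,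
      forall m : {pred Zt}, maximal_ideal m ->
        forall D : lmodType (redalg H m), simple_mod D ->
          exists! G : two_sided_cell S C,
            exists2 o : left_cell S C, cell_of o = G & is_cell_of m D o
    & forall m : {pred Zt}, maximal_ideal m ->
        forall D : lmodType (redalg H m), simple_mod D ->
          forall o : left_cell S C, is_cell_of m D o ->
            in_head (redmod m (cellmod o)) D].
Proof.
move=> cellmod is_cell_of.
(* Of two candidates with distinct cells, the one of smaller or equal height is excluded by the
   minimality of the other. *)
have uniq_cell m D o o' :
    is_cell_of m D o -> is_cell_of m D o' -> cell_of o = cell_of o'.
  move=> [Do minO] [Do' minO']; apply: contrapT => ne.
  by case: (leqP (ht o) (ht o')) => [/minO'|/ltnW/minO] e;
    [apply: Do|apply: Do']; apply: e => // e'; apply: ne.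
have exist_cell m D : maximal_ideal m -> simple_mod D ->
    exists2 o, is_cell_of m D o & in_head (redmod m (cellmod o)) D.
  move=> max_m sD.
  have [o [Do hD above]] := redmod_leading_cell cox heckeT klC max_m sD.
  (* Any other cell whose module contains [D] is strictly above the leading cell for [leLR_op],
     hence has greater height. *)
  exists o => //; split=> // v le_vo ne; apply: contrapT => Dv.
  have [lt _] := ht_compat; have := lt o v (above v Dv) (nesym ne).
  by rewrite ltnNge le_vo.
split=> [E sE|m max_m D sD|m max_m D sD o Do].
- exact: extmod_cell_exists.
- have [o Do _] := exist_cell m D max_m sD.
  exists (cell_of o); split; first by exists o.
  by move=> _ [o' <- Do']; apply: uniq_cell Do Do'.
(* By uniqueness the given cell is the leading one, for which the claim about the head is known. *)
- have [o' Do' hD] := exist_cell m D max_m sD.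
  by move: hD; rewrite /cellmod (uniq_cell m D o' o).
Qed.
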